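(* Let $4\le p<\infty$ and let $f\in \hat{H}^{\frac{1}{p},\frac{p}{2}}(\mathbb{R})$. Then $$\lim_{t\to 0}U(t)f(x)=f(x)$$ for almost every $x\in\mathbb{R}$.
   Context: Fourier transform on $\mathbb{R}^n$: $\hat f(\xi)=(2\pi)^{-n/2}\int_{\mathbb{R}^n}e^{-ix\cdot\xi}f(x)\,dx$, extended to tempered distributions $\mathscr{S}'(\mathbb{R}^n)$. For $s\in\mathbb{R}$ and an exponent $r$ with conjugate exponent $r'$ ($\frac1r+\frac1{r'}=1$), the Fourier-Lebesgue space is $$\hat H^{s,r}(\mathbb{R}^n)=\{f\in\mathscr{S}'(\mathbb{R}^n):\ \|f\|_{\hat H^{s,r}(\mathbb{R}^n)}=\|\langle\xi\rangle^s\hat f\|_{L^{r'}_\xi(\mathbb{R}^n)}<\infty\},\qquad \langle\xi\rangle^s=(1+|\xi|^2)^{s/2}.$$ The Schr\''odinger propagator (solution operator of $iu_t+\Delta u=0$, $u(x,0)=f(x)$) is $$U(t)f(x)=(2\pi)^{-n/2}\int_{\mathbb{R}^n}e^{ix\cdot\xi-it|\xi|^2}\hat f(\xi)\,d\xi,$$ i.e. the inverse Fourier transform of $e^{-it|\xi|^2}\hat f(\xi)$. Here $n=1$. *)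

(* Defs.v *)
From HB Require Import structures.
From mathcomp Require Import all_boot all_order all_algebra.
From mathcomp Require Import complex.
From mathcomp Require Import all_classical all_reals all_analysis.

Set Implicit Arguments.
Unset Strict Implicit.
Unset Printing Implicit Defensive.

Import Order.TTheory GRing.Theory Num.Theory.
Import numFieldNormedType.Exports.

Local Open Scope classical_set_scope.
Local Open Scope ring_scope.
Local Open Scope complex_scope.

Section Defs.
Context {R : realType}.

Local Notation mu := (@lebesgue_measure R).

(* Measurability, integrals and derivatives of complex-valued functions of a
   real variable are taken componentwise. *)

Definition cabs (z : R[i]) : R := ComplexField.Normc.normc z.

Definition cmeasurable (h : R -> R[i]) : Prop :=
  measurable_fun setT (fun x => complex.Re (h x)) /\
  measurable_fun setT (fun x => complex.Im (h x)).

Definition cintegrable (D : set R) (h : R -> R[i]) : Prop :=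
  mu.-integrable D (fun x => (complex.Re (h x))%:E) /\
  mu.-integrable D (fun x => (complex.Im (h x))%:E).

Definition cintegral (D : set R) (h : R -> R[i]) : R[i] :=
  (\int[mu]_(x in D) complex.Re (h x)) +i* (\int[mu]_(x in D) complex.Im (h x)).

Definition smooth (h : R -> R) : Prop :=
  forall (n : nat) (x : R), derivable (derive1n n h) x 1.

Definition cderive1n (n : nat) (h : R -> R[i]) (x : R) : R[i] :=
  derive1n n (fun y => complex.Re (h y)) x +i*
  derive1n n (fun y => complex.Im (h y)) x.

Definition expi (a : R) : R[i] := cos a +i* sin a.

Definition schwartz (phi : R -> R[i]) : Prop :=
  [/\ smooth (fun x => complex.Re (phi x)),
      smooth (fun x => complex.Im (phi x)) &
      forall k n : nat, exists M : R,
        forall x, `|x| ^+ k * cabs (cderive1n n phi x) <= M].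

Definition schwartz_seminorm (k n : nat) (phi : R -> R[i]) : R :=
  sup [set `|x| ^+ k * cabs (cderive1n n phi x) | x in [set: R]].

(* A tempered distribution is given by a functional on all functions
   R -> R[i]; only its values on Schwartz functions are meaningful. *)
Definition tempered_distribution (f : (R -> R[i]) -> R[i]) : Prop :=
  (forall (a : R[i]) (phi psi : R -> R[i]), schwartz phi -> schwartz psi ->
     f (fun x => a * phi x + psi x) = a * f phi + f psi) /\
  (exists (C : R) (N : nat), forall phi : R -> R[i], schwartz phi ->
     cabs (f phi) <=
     C * \sum_(k < N.+1) \sum_(n < N.+1) schwartz_seminorm k n phi).

(* The distribution T is the function g; such a g is unique up to null sets. *)
Definition is_function (T : (R -> R[i]) -> R[i]) (g : R -> R[i]) : Prop :=
  cmeasurable g /\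
  forall phi : R -> R[i], schwartz phi ->
    cintegrable setT (fun x => g x * phi x) /\
    T phi = cintegral setT (fun x => g x * phi x).

Definition fourier (phi : R -> R[i]) (xi : R) : R[i] :=
  ((Num.sqrt (2 * pi))^-1)%:C *
  cintegral setT (fun x => expi (- (x * xi)) * phi x).

Definition fourier_distribution (f : (R -> R[i]) -> R[i]) :
  (R -> R[i]) -> R[i] := fun phi => f (fourier phi).

(* A representative of the Fourier transform of f when that distribution is a
   function, and the zero function otherwise. *)
Definition fhat (f : (R -> R[i]) -> R[i]) : R -> R[i] :=
  xget (fun=> 0) [set g | is_function (fourier_distribution f) g].

Definition japanese_bracket (s xi : R) : R := (1 + xi ^+ 2) `^ (s / 2).

Definition fourier_lebesgue_norm (s : R) (r : \bar R)
    (f : (R -> R[i]) -> R[i]) : \bar R :=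
  Lnorm mu (hoelder_conjugate r)
    (fun xi => (japanese_bracket s xi * cabs (fhat f xi))%:E).

Definition fourier_lebesgue (s : R) (r : \bar R) :
    set ((R -> R[i]) -> R[i]) :=
  [set f | [/\ tempered_distribution f,
               is_function (fourier_distribution f) (fhat f) &
               (fourier_lebesgue_norm s r f < +oo)%E]].

(* The integral defining U(t)f(x) need not converge absolutely, since fhat f
   need not be Lebesgue integrable: it is the limit of the integrals over
   [-N, N] as N tends to +oo. *)
Definition schrodinger_trunc (f : (R -> R[i]) -> R[i]) (t x N : R) : R[i]^o :=
  ((Num.sqrt (2 * pi))^-1)%:C *
  cintegral `[- N, N]
    (fun xi => expi (x * xi - t * xi ^+ 2) * fhat f xi).

Definition schrodinger (f : (R -> R[i]) -> R[i]) (t x : R) : R[i]^o :=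
  lim (schrodinger_trunc f t x N @[N --> +oo]).

Definition schrodinger_defined (f : (R -> R[i]) -> R[i]) (t x : R) : Prop :=
  cvg (schrodinger_trunc f t x N @[N --> +oo]).

End Defs.

(* Main.v *)
Require Import Defs.
From HB Require Import structures.
From mathcomp Require Import all_boot all_order all_algebra.
From mathcomp Require Import complex.
From mathcomp Require Import all_classical all_reals all_analysis.
From mathcomp Require Import measurable_realfun.
From mathcomp Require Import ring lra.

Set Implicit Arguments.
Unset Strict Implicit.
Unset Printing Implicit Defensive.

Import Order.TTheory GRing.Theory Num.Theory.
Import numFieldNormedType.Exports.

Local Open Scope classical_set_scope.
Local Open Scope ring_scope.
Local Open Scope complex_scope.

(* Write [g = a + i b] for the Fourier transform of [f] and [q = p / (p - 2)].
   By hypothesis [D = (<xi>^(1/p) |g|)^q] is integrable.  No interpolation is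
   needed to use it: with [A = <xi>^(1/2)] one has [D A = (A |g|)^q] with
   [1 <= q <= 2], so pointwise [|g| <= D] where [A |g| >= 1] and
   [A |g|^2 <= D] where [A |g| < 1].  On the first set [g] is integrable, and on
   the second one it behaves like the transform of a function in [H^(1/4)].

   For the second set, the maximal function over [t] and over the
   truncation [N] is linearized and treated by the TT* method.  The kernel is
   the integral of [|xi|^(-1/2) cos(x xi - t xi^2)] over a band, which is
   [O(|x|^(-1/2))] uniformly in [t] and in the band; integrating it against the
   weight [1 / (1 + x^2)] gives a weighted L1 bound of the maximal function of
   the tail [|xi| > m] by a quantity that tends to 0 as [m] grows.  Hence, for
   almost every [x], the truncated integrals converge uniformly in [t], so that
   the limit exists for every [t] and is continuous at [t = 0].

   The truncated integrals at [t = 0] also converge in weighted L1, and Fourier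
   inversion for Schwartz functions, obtained by Abel summation and the Poisson
   kernel, identifies their limit with the distribution [f]. *)

(** * Derivatives and the fundamental theorem of calculus *)

Section Deriv.
Context {R : realType}.
Implicit Types (f g : R -> R) (x a b : R).

(** On bounded frequencies the bound [|g| <= 1 + D] suffices: each band [|xi| <= N] is treated by
    dominated convergence. The difficulty is the tail. Since the integrals converge only
    conditionally, it must be small uniformly in [t] and [N] at once; the limits in [N] and [t] can
    then be exchanged at a fixed [x], with no approximation of [f] by nicer data.

    The TT* bound alone does not give smallness, because its constant does not decay in [m]. The
    pairing of [g] with the adjoint is therefore split by the inequality of arithmetic and geometric
    means with a free parameter [l]: the adjoint enters with the factor [1 / l], the density with
    the factor [l]. Choosing [l] large first and [m] afterwards makes both terms small.

    A kernel of size [|x|^(-1/2)] is integrable at 0 but not at infinity, which is why a weight is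
    needed. Almost everywhere statements do not see the weight, and Schwartz functions are dominated
    by a multiple of it, so the same estimates also serve to identify the limit with [f]. *)

Lemma derD f g x a b : is_derive x 1 f a -> is_derive x 1 g b ->
  is_derive x 1 (fun y => f y + g y) (a + b).
Proof. by move=> *; apply: is_deriveD. Qed.

Lemma derB f g x a b : is_derive x 1 f a -> is_derive x 1 g b ->
  is_derive x 1 (fun y => f y - g y) (a - b).
Proof. by move=> *; apply: is_deriveB. Qed.

Lemma derN f x a : is_derive x 1 f a -> is_derive x 1 (fun y => - f y) (- a).
Proof. by move=> *; apply: is_deriveN. Qed.

Lemma derM f g x a b : is_derive x 1 f a -> is_derive x 1 g b ->
  is_derive x 1 (fun y => f y * g y) (f x * b + g x * a).
Proof. by move=> *; apply: is_deriveM. Qed.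

Lemma derX f n x a : is_derive x 1 f a ->
  is_derive x 1 (fun y => f y ^+ n) (n%:R * f x ^+ n.-1 * a).
Proof.
move=> df; rewrite (_ : (fun y => _) = f ^+ n); last by rewrite exprfctE.
exact: is_deriveX.
Qed.

Lemma derV f x a : f x != 0 -> is_derive x 1 f a ->
  is_derive x 1 (fun y => (f y)^-1) (- (f x) ^- 2 * a).
Proof. by move=> *; apply: is_deriveV. Qed.

Lemma derC c x : is_derive x 1 (fun=> c : R) 0.
Proof. exact: is_derive_cst. Qed.

Lemma derI x : is_derive x 1 (fun y : R => y) 1.
Proof. exact: is_derive_id. Qed.

Lemma derZ (c : R) f x a : is_derive x 1 f a -> is_derive x 1 (fun y => c * f y) (c * a).
Proof.
by move=> df; apply: is_derive_eq (derM (derC c x) df) _; rewrite mulr0 addr0.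
Qed.

Lemma derF (F : R -> R) f x a b : is_derive (f x) 1 F b -> is_derive x 1 f a ->
  is_derive x 1 (fun y => F (f y)) (b * a).
Proof. by move=> *; exact: (@is_derive1_comp R F f). Qed.

Lemma der_sqrt x : 0 < x -> is_derive x 1 Num.sqrt (2 * Num.sqrt x)^-1.
Proof. by move=> x0; exact: is_derive1_sqrt. Qed.

Lemma der_cont f x a : is_derive x 1 f a -> {for x, continuous f}.
Proof. by case=> df _; exact/differentiable_continuous/derivable1_diffP. Qed.

End Deriv.

(* The side conditions [f x != 0] and [0 < f x] are left over. *)
Ltac der :=
  lazymatch goal with
  | |- is_derive _ _ (fun _ => ?c) _ => notypeclasses refine (derC _ _)
  | |- is_derive _ _ (fun y => y) _ => notypeclasses refine (derI _)
  | |- is_derive _ _ (fun y => @?f y + - @?g y) _ =>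
      notypeclasses refine (derB (f := f) (g := g) _ _); der
  | |- is_derive _ _ (fun y => @?f y + @?g y) _ =>
      notypeclasses refine (derD (f := f) (g := g) _ _); der
  | |- is_derive _ _ (fun y => - @?f y) _ =>
      notypeclasses refine (derN (f := f) _); der
  | |- is_derive _ _ (fun y => @?f y * @?g y) _ =>
      notypeclasses refine (derM (f := f) (g := g) _ _); der
  | |- is_derive _ _ (fun y => @?f y ^+ ?n) _ =>
      notypeclasses refine (derX (f := f) n _); der
  | |- is_derive _ _ (fun y => (@?f y)^-1) _ =>
      notypeclasses refine (derV (f := f) _ _); [|der]
  | |- is_derive _ _ (fun y => cos (@?f y)) _ =>
      notypeclasses refine (derF (F := cos) (f := f) (is_derive_cos _) _); der
  | |- is_derive _ _ (fun y => sin (@?f y)) _ =>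
      notypeclasses refine (derF (F := sin) (f := f) (is_derive_sin _) _); der
  | |- is_derive _ _ (fun y => expR (@?f y)) _ =>
      notypeclasses refine (derF (F := expR) (f := f) (is_derive_expR _) _); der
  | |- is_derive _ _ (fun y => atan (@?f y)) _ =>
      notypeclasses refine (derF (F := atan) (f := f) (is_derive1_atan _) _); der
  | |- is_derive _ _ (fun y => Num.sqrt (@?f y)) _ =>
      notypeclasses refine (derF (F := Num.sqrt) (f := f) (der_sqrt _) _); [|der]
  | |- _ => idtac
  end.

Section SinCos.
Context {R : realType}.

Lemma cos_bound (x : R) : `|cos x| <= 1.
Proof. by rewrite ler_norml cos_geN1 cos_le1. Qed.

Lemma sin_bound (x : R) : `|sin x| <= 1.
Proof. by rewrite ler_norml sin_geN1 sin_le1. Qed.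

Lemma measurable_cos : measurable_fun [set: R] (@cos R).
Proof. exact: (continuous_measurable_fun (@continuous_cos R)). Qed.

Lemma measurable_sin : measurable_fun [set: R] (@sin R).
Proof. exact: (continuous_measurable_fun (@continuous_sin R)). Qed.

End SinCos.

#[local] Hint Resolve cos_bound sin_bound measurable_cos measurable_sin : core.

Section FTC.
Context {R : realType}.
Local Notation mu := (@lebesgue_measure R).
Implicit Types (f F : R -> R) (a b : R).

Lemma ftc F f a b : a <= b ->
  (forall x, a <= x <= b -> is_derive x 1 F (f x)) ->
  (forall x, a <= x <= b -> {for x, continuous f}) ->
  mu.-integrable `[a, b] (EFin \o f) /\
  \int[mu]_(x in `[a, b]) f x = F b - F a.
Proof.
move=> ab dF cf.
have cfi : {within `[a, b], continuous f}.
  by apply: continuous_in_subspaceT => x /set_mem; rewrite /= in_itv /=; exact: cf.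
split; first by apply: continuous_compact_integrable => //; exact: segment_compact.
move: ab; rewrite le_eqVlt => /predU1P[<-|ab].
  by rewrite set_itv1 Rintegral_set1 subrr.
rewrite /Rintegral (@continuous_FTC2 _ f F) -?EFinB//=.
  split.
  - by move=> x; rewrite in_itv /= => /andP[? ?]; case: (dF x) => //; rewrite !ltW.
  - by apply: cvg_at_right_filter; apply: der_cont (dF a _); rewrite lexx ltW.
  - by apply: cvg_at_left_filter; apply: der_cont (dF b _); rewrite lexx ltW.
move=> x; rewrite in_itv /= => /andP[? ?]; rewrite derive1E.
by case: (dF x) => //; rewrite !ltW.
Qed.

(** The integrand needs no primitive of its own: a continuous majorant with a known primitive is
    enough. *)
Lemma ftc_le F f g a b : a <= b ->
  (forall x, a <= x <= b -> is_derive x 1 F (g x)) ->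
  (forall x, a <= x <= b -> {for x, continuous g}) ->
  (forall x, a <= x <= b -> {for x, continuous f}) ->
  (forall x, a <= x <= b -> f x <= g x) ->
  \int[mu]_(x in `[a, b]) f x <= F b - F a.
Proof.
move=> ab dF cg cf fg.
have [ig <-] := ftc ab dF cg.
apply: le_Rintegral => //.
apply: continuous_compact_integrable; first exact: segment_compact.
by apply: continuous_in_subspaceT => x /set_mem; rewrite /= in_itv /=; exact: cf.
Qed.

End FTC.

(** * Oscillatory integrals with a quadratic phase *)

Section Kernel.
Context {R : realType}.
Local Notation mu := (@lebesgue_measure R).
Implicit Types s u y c m M : R.

(* The phase [u x - s' x ^+ 2] after the substitution [x = y ^+ 2 / u], which
   absorbs the weight [(sqrt x)^-1]. *)
Let ph s y := y ^+ 2 - s * y ^+ 4.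
Let ph1 s y := 2 * y - 4 * s * y ^+ 3.
Let ph2 s y := 2 - 12 * s * y ^+ 2.

(** The stationary points on the half-line are 0 and, for [s > 0], a point [c]; [|ph1|] is at least
    the distance to the nearer of them, whatever the size of [s]. The second derivative is not
    bounded uniformly in [s], but it is bounded on one side, by 2 from below or from above, so that
    up to a constant its modulus is [e] times itself. That term is harmless because
    [ph2 / (1 + ph1^2)] is the derivative of [atan ph1]. *)
Lemma quartic_phase_nondegenerate s : exists c e : R, [/\ `|e| <= 1,
  (forall y, 0 <= y ->
    (1 + ph1 s y ^+ 2)^-1 <= (1 + y ^+ 2)^-1 + (1 + (y - c) ^+ 2)^-1) &
  (forall y, `|ph2 s y| <= 4 + e * ph2 s y)].
Proof.
have D (z : R) : 0 < 1 + z ^+ 2 by rewrite ltr_pwDl// sqr_ge0.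
have V (z w : R) : w ^+ 2 <= z ^+ 2 -> (1 + z ^+ 2)^-1 <= (1 + w ^+ 2)^-1.
  by move=> h; rewrite lef_pV2 ?posrE// lerD2l.
have P (w : R) : 0 <= (1 + w ^+ 2)^-1 by rewrite invr_ge0 ltW.
have [s0|s0] := leP s 0.
  exists 0, 1; split.
  - by rewrite normr1.
  - move=> y y0; apply: (@le_trans _ _ (1 + y ^+ 2)^-1); last by rewrite lerDl.
    apply: V; have h : y <= ph1 s y.
      have : 0 <= - s * y ^+ 3 by rewrite mulr_ge0 ?oppr_ge0// exprn_ge0.
      by rewrite /ph1; lra.
    by rewrite ler_sqr ?nnegrE// (le_trans y0).
  - move=> y; have : 0 <= - s * y ^+ 2 by rewrite mulr_ge0 ?oppr_ge0// sqr_ge0.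
    by rewrite /ph2 => h; rewrite ger0_norm; lra.
have s2 : 0 < (2 * s)^-1 by rewrite invr_gt0 mulr_gt0.
(* The positive zero of [ph1]; hence the factorization [c^2 ph1 = 2 y (c + y) (c - y)] below. *)
pose c := Num.sqrt (2 * s)^-1.
have c0 : 0 < c by rewrite sqrtr_gt0.
have sc : 2 * s * c ^+ 2 = 1 by rewrite sqr_sqrtr ?(ltW s2)// mulfV// gt_eqF// mulr_gt0.
have E y : c ^+ 2 * ph1 s y = 2 * y * (c + y) * (c - y).
  have -> : c ^+ 2 * ph1 s y = 2 * y * c ^+ 2 - 2 * (2 * s * c ^+ 2) * y ^+ 3.
    by rewrite /ph1; ring.
  by rewrite sc; ring.
have c20 : 0 < c ^+ 2 by rewrite exprn_gt0.
exists c, (-1); split; first by rewrite normrN1.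
  move=> y y0; have [yc|yc] := leP (2 * y) c.
    apply: (@le_trans _ _ (1 + y ^+ 2)^-1); last by rewrite lerDl.
    apply: V; have h : y <= ph1 s y.
      rewrite -(ler_pM2l c20) E.
      have : c ^+ 2 <= 2 * ((c + y) * (c - y)) by nra.
      by move/(ler_wpM2l y0); lra.
    by rewrite ler_sqr ?nnegrE// (le_trans y0).
  apply: (@le_trans _ _ (1 + (y - c) ^+ 2)^-1); last by rewrite lerDr.
  apply: V; rewrite -[leLHS]real_normK ?num_real// -[leRHS]real_normK ?num_real//.
  rewrite ler_sqr ?nnegrE//.
  rewrite -(ler_pM2l c20) -{2}(gtr0_norm c20) -normrM E normrM distrC.
  by apply: ler_wpM2r => //; rewrite ger0_norm; nra.
move=> y; have : 0 <= s * y ^+ 2 by rewrite mulr_ge0 ?(ltW s0)// sqr_ge0.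
rewrite /ph2 => h; rewrite ler_norml; apply/andP; split; lra.
Qed.

Lemma atan_bound (x : R) : `|atan x| <= pi / 2.
Proof. by rewrite ler_norml (ltW (atan_gtNpi2 _)) (ltW (atan_ltpi2 _)). Qed.

(** Each endpoint contributes at most [1 + 11 (pi / 2)]; the outer factor 2 comes from
    [dx / sqrt x = (2 / sqrt u) dy]. *)
Definition osc_const : R := 2 * (2 + 22 * (pi / 2)).

Lemma osc_const_ge0 : 0 <= osc_const.
Proof. by rewrite /osc_const; have := pi_ge0 R; lra. Qed.

(* Integrating [cos ph] by parts against [ph1 / (1 + ph1 ^+ 2)], which is not
   singular at the stationary points of the phase, leaves an error at most
   [(1 + |ph2|) / (1 + ph1 ^+ 2)], which is dominated by the derivative of a
   combination of three arctangents. *)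
Lemma quartic_phase_primitive a s : exists G g : R -> R, [/\
  forall y, 0 <= y -> is_derive y 1 G (g y),
  forall y, {for y, continuous g},
  forall y, 0 <= y -> cos (a + ph s y) <= g y &
  forall y, `|G y| <= 1 + 11 * (pi / 2)].
Proof.
have D (z : R) : 0 < 1 + z ^+ 2 by rewrite ltr_pwDl// sqr_ge0.
have N (z : R) : 1 + z ^+ 2 != 0 by rewrite gt_eqF.
have [c [e [e1 cP eP]]] := quartic_phase_nondegenerate s.
pose k y := 1 + ph1 s y ^+ 2.
(* The coefficient 5 is 1 + 4: one unit pays for [cos / (1 + ph1^2)], the other four come from
   [|ph2| <= 4 + e ph2]. The remaining [e ph2 / (1 + ph1^2)] is the derivative of the last
   arctangent. *)
exists (fun y => ph1 s y * (k y)^-1 * sin (a + ph s y) +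
   (5 * atan y + 5 * atan (y - c) + e * atan (ph1 s y))).
exists (fun y => ph2 s y * (2 * (k y)^-1 - 1) * (k y)^-1 * sin (a + ph s y) +
   (1 - (k y)^-1) * cos (a + ph s y) +
   (5 * (1 + y ^+ 2)^-1 + 5 * (1 + (y - c) ^+ 2)^-1 + e * ((k y)^-1 * ph2 s y))).
split.
- move=> y _; simple notypeclasses refine (is_derive_eq _ _); [|by rewrite /k /ph /ph1; der; exact: N|].
  rewrite /k /ph2 -/(ph s y) -/(ph1 s y) add0r /=.
  have -> : 2 * y ^+ 1 * 1 - (s * (4 * y ^+ 3 * 1) + y ^+ 4 * 0) = ph1 s y.
    by rewrite /ph1; ring.
  have -> : 2 * 1 + y * 0 - (4 * s * (3 * y ^+ 2 * 1) + y ^+ 3 * 0) = ph2 s y.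
    by rewrite /ph2; ring.
  rewrite -/(ph2 s y); set C := cos _; set S := sin _.
  move: (ph1 s y) (ph2 s y) (N (ph1 s y)) => p q Np.
  by field; rewrite Np !N.
- by move=> y; rewrite /k /ph /ph1 /ph2; simple notypeclasses refine (der_cont _); [|der; exact: N].
- move=> y y0; set C := cos _; set S := sin _.
  have S1 : `|S| <= 1 by rewrite ler_norml sin_geN1 sin_le1.
  have C1 : C <= 1 by exact: cos_le1.
  have := cP _ y0; have := eP y; rewrite /k.
  have : 0 < (1 + ph1 s y ^+ 2)^-1 by rewrite invr_gt0.
  have : (1 + ph1 s y ^+ 2)^-1 <= 1 by rewrite invf_le1// lerDl sqr_ge0.
  move: (1 + _)^-1 (1 + _)^-1 (1 + _)^-1 (ph2 s y) => B A V q V1 V0 qe VAB.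
  have : - (q * (2 * V - 1) * S) <= `|q|.
    rewrite (le_trans (ler_norm _))// normrN !normrM -mulrA ler_piMr//.
    by rewrite mulr_ile1// ler_norml; apply/andP; split; lra.
  move/(ler_wpM2l (ltW V0)) => h1; have h2 := ler_wpM2l (ltW V0) qe.
  have h3 := ler_wpM2l (ltW V0) C1.
  lra.
- move=> y; rewrite (le_trans (ler_normD _ _))// lerD//.
    rewrite normrM mulr_ile1//; last by rewrite ler_norml sin_geN1 sin_le1.
    rewrite normrM normfV (gtr0_norm (D _)) ler_pdivrMr ?D// mul1r.
    by rewrite ler_norml; apply/andP; split; nra.
  have a1 := atan_bound y; have a2 := atan_bound (y - c).
  have a3 := atan_bound (ph1 s y).
  have : `|e * atan (ph1 s y)| <= pi / 2.
    by rewrite normrM -[leRHS]mul1r ler_pM.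
  move: a1 a2; rewrite !ler_norml => /andP[? ?] /andP[? ?] /andP[? ?].
  by apply/andP; split; lra.
Qed.

(** With [y = sqrt (u x)] the phase [u x - s x^2] becomes [y^2 - (s / u^2) y^4], whose estimate does
    not depend on the coefficient, hence not on [s]. Only an upper bound is obtained this way; the
    constant phase [a] is carried along to deduce the lower one. *)
Lemma oscillatory_integral_le a u s m M : 0 < u -> 0 < m -> m <= M ->
  \int[mu]_(x in `[m, M]) (cos (a + (u * x - s * x ^+ 2)) * (Num.sqrt x)^-1)
  <= osc_const * (Num.sqrt u)^-1.
Proof.
move=> u0 m0 mM.
have [G [g [dG cg Gc Gb]]] := quartic_phase_primitive a (s / u ^+ 2).
have su0 : 0 < Num.sqrt u by rewrite sqrtr_gt0.
pose Y x := Num.sqrt u * Num.sqrt x.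
pose k := 2 * (Num.sqrt u)^-1.
apply: (@le_trans _ _ (k * G (Y M) - k * G (Y m))).
  apply: (ftc_le (F := fun x => k * G (Y x)) (g := fun x => g (Y x) * (Num.sqrt x)^-1)) => //.
  - move=> x /andP[mx _]; have x0 := lt_le_trans m0 mx.
    have sx0 : 0 < Num.sqrt x by rewrite sqrtr_gt0.
    apply: (is_derive_eq (f' := k * (g (Y x) * (Num.sqrt u * ((2 * Num.sqrt x)^-1 * 1)
      + Num.sqrt x * 0)) + G (Y x) * 0)).
      rewrite /Y; der; notypeclasses refine (derF (F := G) (dG _ _) _); last by der.
      by rewrite mulr_ge0 ?ltW.
    by rewrite /k; field; rewrite !gt_eqF.
  - move=> x /andP[mx _]; have x0 := lt_le_trans m0 mx.
    have sx0 : 0 < Num.sqrt x by rewrite sqrtr_gt0.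
    have cs : {for x, continuous (@Num.sqrt R)} by exact: (der_cont (der_sqrt x0)).
    apply: cvgM; last by apply: cvgV; rewrite ?gt_eqF.
    by apply: (cvg_comp Y g); [exact: cvgM (@cvg_cst _ _ _ _ _) cs|exact: cg].
  - move=> x /andP[mx _]; have x0 := lt_le_trans m0 mx.
    have sx0 : 0 < Num.sqrt x by rewrite sqrtr_gt0.
    simple notypeclasses refine (der_cont _); [|der] => //; by rewrite gt_eqF.
  - move=> x /andP[mx _]; have x0 := lt_le_trans m0 mx.
    have sx0 : 0 < Num.sqrt x by rewrite sqrtr_gt0.
    rewrite ler_pM2r ?invr_gt0// (le_trans _ (Gc _ _))//; last by rewrite mulr_ge0// ltW.
    rewrite le_eqVlt; apply/orP; left; apply/eqP; congr (cos (a + _)).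
    rewrite /ph /Y (_ : 4 = 2 * 2)%N// !exprM !exprMn !sqr_sqrtr ?(ltW x0) ?(ltW u0)//.
    by field; rewrite gt_eqF.
have := Gb (Y M); have := Gb (Y m); rewrite !ler_norml => /andP[? ?] /andP[? ?].
have k0 : 0 < (Num.sqrt u)^-1 by rewrite invr_gt0.
rewrite -mulrBr /k mulrAC ler_pM2r// /osc_const.
lra.
Qed.

(** The lower bound is the upper bound for the phase shifted by [pi], which changes the sign of the
    cosine. *)
Lemma oscillatory_integral_bound u s m M : 0 < u -> 0 < m -> m <= M ->
  `|\int[mu]_(x in `[m, M]) (cos (u * x - s * x ^+ 2) * (Num.sqrt x)^-1)|
  <= osc_const * (Num.sqrt u)^-1.
Proof.
move=> u0 m0 mM.
have h := oscillatory_integral_le 0 s u0 m0 mM.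
have h' := oscillatory_integral_le pi s u0 m0 mM.
rewrite ler_norml lerNl; apply/andP; split; last first.
  by under eq_Rintegral do rewrite -[_ - _]add0r.
rewrite (le_trans _ h')//.
under [leRHS]eq_Rintegral do rewrite addrC cosDpi mulNr.
rewrite -mulN1r -RintegralZl//.
  by rewrite le_eqVlt; apply/orP; left; apply/eqP; apply: eq_Rintegral => x _; rewrite mulN1r.
apply: continuous_compact_integrable; first exact: segment_compact.
apply: continuous_in_subspaceT => x /set_mem; rewrite /= in_itv /= => /andP[mx _].
have x0 := lt_le_trans m0 mx.
by simple notypeclasses refine (der_cont _); [|der] => //; rewrite gt_eqF// sqrtr_gt0.
Qed.
End Kernel.

(** * Real-valued Lebesgue integrals *)

Section RealIntegral.
Context {R : realType}.
Local Notation mu := (@lebesgue_measure R).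
Local Notation I f := (mu.-integrable [set: R] (EFin \o f)).
Implicit Types f g : R -> R.

Lemma intD f g : I f -> I g -> I (fun x => f x + g x).
Proof. by move=> jf jg; have := integrableD measurableT jf jg; apply: eq_integrable. Qed.

Lemma intB f g : I f -> I g -> I (fun x => f x - g x).
Proof. by move=> jf jg; have := integrableB measurableT jf jg; apply: eq_integrable. Qed.

Lemma intZ k f : I f -> I (fun x => k * f x).
Proof. by move=> jf; have := integrableZl measurableT k jf; apply: eq_integrable. Qed.

Lemma eq_int f g : f =1 g -> I f -> I g.
Proof. by move=> /funext ->. Qed.

Lemma int_meas f : I f -> measurable_fun [set: R] f.
Proof. by move=> jf; apply/measurable_EFinP; exact: measurable_int jf. Qed.

Lemma le_int f g : measurable_fun [set: R] f -> (forall x, `|f x| <= `|g x|) ->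
  I g -> I f.
Proof.
move=> mf fg jg; apply: (le_integrable _ _ _ jg) => //; first exact/measurable_EFinP.
by move=> x _; rewrite lee_fin.
Qed.

Lemma RintD f g : I f -> I g ->
  \int[mu]_x (f x + g x) = \int[mu]_x f x + \int[mu]_x g x.
Proof. by move=> jf jg; rewrite RintegralD. Qed.

Lemma RintB f g : I f -> I g ->
  \int[mu]_x (f x - g x) = \int[mu]_x f x - \int[mu]_x g x.
Proof. by move=> jf jg; rewrite RintegralB. Qed.

Lemma RintZ k f : I f -> \int[mu]_x (k * f x) = k * \int[mu]_x f x.
Proof. by move=> jf; rewrite RintegralZl. Qed.

Lemma eq_Rint f g : f =1 g -> \int[mu]_x f x = \int[mu]_x g x.
Proof. by move=> fg; apply: eq_Rintegral => x _; rewrite fg. Qed.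

Lemma le_Rint f g : I f -> I g -> (forall x, f x <= g x) ->
  \int[mu]_x f x <= \int[mu]_x g x.
Proof. by move=> jf jg fg; apply: le_Rintegral. Qed.

Lemma normr_Rint f g : I f -> I g -> (forall x, `|f x| <= g x) ->
  `|\int[mu]_x f x| <= \int[mu]_x g x.
Proof.
move=> jf jg fg; apply: (le_trans (le_normr_Rintegral _ jf)) => //.
by apply: le_Rint => //; exact: integrable_norm.
Qed.

Lemma Rint_cvg (f_ : (R -> R)^nat) f g :
  (forall n, measurable_fun [set: R] (f_ n)) ->
  (forall x, f_ n x @[n --> \oo] --> f x) -> I g ->
  (forall n x, `|f_ n x| <= g x) ->
  I f /\ \int[mu]_x f_ n x @[n --> \oo] --> \int[mu]_x f x.
Proof.
move=> mf cf jg fg.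
have mf' n : measurable_fun [set: R] (EFin \o f_ n) by exact/measurable_EFinP.
have cE x : (f_ n x)%:E @[n --> \oo] --> (f x)%:E by apply: cvg_EFin; [exact: nearW|exact: cf].
have mfl : measurable_fun [set: R] (EFin \o f).
  exact: emeasurable_fun_cvg (fun n => mf' n) (fun x _ => cE x).
have [|||jf _ h] := @dominated_convergence _ _ R mu _ measurableT (fun n => EFin \o f_ n)
  (EFin \o f) (EFin \o g) mf' mfl.
- by apply: aeW => x _; exact: cE.
- exact: jg.
- by apply: aeW => x n _; rewrite lee_fin; exact: fg.
split => //; apply: fine_cvg; rewrite fineK; first exact: h.
exact: integrable_fin_num.
Qed.

End RealIntegral.

(** * Fubini's theorem for real-valued integrals *)

Section Fubini.
Context {R : realType}.
Local Notation mu := (@lebesgue_measure R).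
Local Notation T := (measurableTypeR R).
Implicit Types (k : T * T -> R) (u v : R -> R).

(** An integrable function is finite almost everywhere, so [fine] alters it on a null set only. This
    turns the extended-real inner integrals of Fubini's theorem into real ones. *)
Lemma integrable_fineP (f : T -> \bar R) : mu.-integrable setT f ->
  mu.-integrable setT (fun x => (fine (f x))%:E) /\
  (\int[mu]_x (fine (f x))%:E = \int[mu]_x f x)%E.
Proof.
move=> intf; have mf := measurable_int _ intf.
have mff : measurable_fun setT (EFin \o (fine \o f)).
  by apply/measurable_EFinP; exact: measurableT_comp.
split.
  apply: (le_integrable _ mff _ intf) => // x _.
  by rewrite /=; case: (f x) => [r| |]; rewrite /= ?normr0 ?leey ?lexx.
apply: (ae_eq_integral _ _ measurableT mff mf).
have := integrable_ae measurableT intf; apply: filterS => x /(_ I) fx _.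
by rewrite /= fineK.
Qed.

(** Tonelli's theorem: the majorant is a product, so its double integral factors. *)
Lemma integrable_prod k u v : measurable_fun setT k ->
  mu.-integrable setT (EFin \o u) -> mu.-integrable setT (EFin \o v) ->
  (forall x y, `|k (x, y)| <= u x * v y) ->
  (mu \x mu)%E.-integrable setT (EFin \o k).
Proof.
move=> mk iu iv kuv.
have mu_ : measurable_fun setT u by apply/measurable_EFinP; exact: measurable_int iu.
have mv : measurable_fun setT v by apply/measurable_EFinP; exact: measurable_int iv.
have mak : measurable_fun setT (abse \o (EFin \o k)).
  by apply: measurableT_comp => //; exact/measurable_EFinP.
have mauv : measurable_fun setT (fun z : T * T => (`|u z.1|%:E * `|v z.2|%:E)%E).
  apply: emeasurable_funM; apply/measurable_EFinP; apply: measurableT_comp => //;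
     exact: measurableT_comp.
apply/integrable12ltyP; first exact/measurable_EFinP.
apply: (@le_lt_trans _ _ (\int[mu]_x \int[mu]_y (`|u x|%:E * `|v y|%:E))%E).
  apply: ge0_le_integral => //.
  - by move=> x _; exact: integral_ge0.
  - by apply: (measurable_fun_fubini_tonelli_F (m2 := mu) _ mak) => z; rewrite abse_ge0.
  - by apply: (measurable_fun_fubini_tonelli_F (m2 := mu) _ mauv) => z; rewrite mule_ge0.
  - move=> x _; apply: ge0_le_integral => //=.
    + exact: (measurableT_comp mak (pair1_measurable _)).
    + exact: (measurableT_comp mauv (pair1_measurable _)).
    + by move=> y _; rewrite -EFinM lee_fin -normrM (le_trans (kuv _ _))// ler_norm.
under eq_integral => x _.
  rewrite ge0_integralZl//; last by apply/measurable_EFinP; apply: measurableT_comp.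
  over.
rewrite ge0_integralZr//=.
- apply: lte_mul_pinfty.
  + by apply: integral_ge0.
  + apply: integrable_fin_num => //; exact: (integrable_norm iu).
  + apply: integrable_lty => //; exact: (integrable_norm iv).
- by apply/measurable_EFinP; apply: measurableT_comp.
- exact: integral_ge0.
Qed.

Lemma Rintegral_fubini k : (mu \x mu)%E.-integrable setT (EFin \o k) ->
  [/\ mu.-integrable setT (fun x => (\int[mu]_y k (x, y))%:E),
      mu.-integrable setT (fun y => (\int[mu]_x k (x, y))%:E) &
      \int[mu]_x \int[mu]_y k (x, y) = \int[mu]_y \int[mu]_x k (x, y)].
Proof.
move=> ik.
have [iF eF] := integrable_fineP (integrable_fubini_F ik).
have mG : measurable_fun setT (fubini_G mu (EFin \o k)) := measurable_fubini_G ik.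
have iG' : mu.-integrable setT (fubini_G mu (EFin \o k)).
  apply/integrableP; split => //.
  have /(integrable21ltyP mu mu (measurable_int _ ik)) := ik.
  apply: le_lt_trans; apply: ge0_le_integral => //.
  - exact: measurableT_comp.
  - apply: (measurable_fun_fubini_tonelli_G (m1 := mu) (abse \o (EFin \o k))) => //=.
    by apply: measurableT_comp => //; exact: measurable_int ik.
  - move=> y _; apply: le_abse_integral => //.
    exact: (measurableT_comp (measurable_int _ ik) (measurable_pair2 _)).
have [iG eG] := integrable_fineP iG'.
split => //; congr fine; rewrite eF eG; exact: (Fubini ik).
Qed.

End Fubini.

(** * The singularity [|x|^(-1/2)] against the weight [1 / (1 + x^2)] *)

Section SingularWeight.
Context {R : realType}.
Local Notation mu := (@lebesgue_measure R).
Implicit Types (x y : R).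

Lemma measurable_sqrtV : measurable_fun [set: R] (fun y : R => (Num.sqrt `|y|)^-1).
Proof.
rewrite (_ : (fun _ => _) = (fun z => z `^ (- 2^-1)) \o Num.norm).
  by apply: (measurableT_comp (measurable_powR _)).
by apply/funext => y /=; rewrite powRN powR12_sqrt.
Qed.

Let mh x : measurable_fun [set: R] (fun y => ((Num.sqrt `|x - y|)^-1)%:E).
Proof.
apply/measurable_EFinP; apply: (measurableT_comp measurable_sqrtV).
exact: measurable_funB.
Qed.

Let cvg_bound (u : (\bar R)^nat) (l c : \bar R) : u n @[n --> \oo] --> l ->
  (forall n, u n <= c)%E -> (l <= c)%E.
Proof.
move=> ul uc; rewrite -(cvg_lim _ ul)//.
by apply: lime_le; [apply/cvg_ex; exists l|exact: nearW].
Qed.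

(** The interval is exhausted by [[x + 1 / (n + 1), x + 1]], on which the primitive [2 sqrt (y - x)]
    is differentiable. *)
Lemma integral_sqrtV_right x :
  (\int[mu]_(y in `]x, (x + 1)%R]) ((Num.sqrt `|x - y|)^-1)%:E <= 2%:E)%E.
Proof.
rewrite itv_open_bnd_bigcup.
have n0 n : 0 < n.+1%:R^-1 :> R by rewrite invr_gt0 ltr0n.
have n1 n : n.+1%:R^-1 <= 1 :> R by rewrite invf_le1 ?ltr0n// ler1n.
apply: cvg_bound; first apply: ge0_nondecreasing_set_cvg_integral.
- move=> n m nm; apply/subsetPset => y /=; rewrite !in_itv /= => /andP[h ->].
  by rewrite andbT (le_trans _ h)// lerD2l lef_pV2 ?posrE ?ltr0n// ler_nat.
- by [].
- by move=> n; apply: measurable_funTS; exact: mh.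
- by move=> n y _; rewrite lee_fin invr_ge0 sqrtr_ge0.
move=> n.
have [|||ih eh] := @ftc R (fun y => 2 * Num.sqrt (y - x))
  (fun y => (Num.sqrt `|x - y|)^-1) (x + n.+1%:R^-1) (x + 1).
- by rewrite lerD2l.
- move=> y /andP[xy _].
  have yx : 0 < y - x by rewrite subr_gt0 (lt_le_trans _ xy)// ltrDl.
  apply: (is_derive_eq (f' := 2 * ((2 * Num.sqrt (y - x))^-1 * (1 - 0)) + Num.sqrt (y - x) * 0)).
    by der.
  rewrite distrC gtr0_norm// subr0 mulr1 mulr0 addr0 invfM mulrA divff ?mul1r//.
- move=> y /andP[xy _].
  have yx : 0 < y - x by rewrite subr_gt0 (lt_le_trans _ xy)// ltrDl.
  apply: cvgV; first by rewrite gt_eqF// sqrtr_gt0 distrC gtr0_norm.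
  apply: (cvg_comp (fun y => `|x - y|)); last exact: sqrt_continuous.
  by apply: cvg_norm; apply: cvgB => //; exact: cvg_cst.
rewrite -(fineK (integrable_fin_num _ ih))// -/(Rintegral _ _ _) [Rintegral _ _ _]eh lee_fin.
rewrite (_ : x + 1 - x = 1); last by ring.
rewrite sqrtr1 mulr1.
by rewrite lerBlDr lerDl mulr_ge0// sqrtr_ge0.
Qed.

Lemma integral_sqrtV_left x :
  (\int[mu]_(y in `[(x - 1)%R, x[) ((Num.sqrt `|x - y|)^-1)%:E <= 2%:E)%E.
Proof.
rewrite itv_bnd_open_bigcup.
have n0 n : 0 < n.+1%:R^-1 :> R by rewrite invr_gt0 ltr0n.
have n1 n : n.+1%:R^-1 <= 1 :> R by rewrite invf_le1 ?ltr0n// ler1n.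
apply: cvg_bound; first apply: ge0_nondecreasing_set_cvg_integral.
- move=> n m nm; apply/subsetPset => y /=; rewrite !in_itv /= => /andP[-> h].
  by rewrite (le_trans h)// lerD2l lerN2 lef_pV2 ?posrE ?ltr0n// ler_nat.
- by [].
- by move=> n; apply: measurable_funTS; exact: mh.
- by move=> n y _; rewrite lee_fin invr_ge0 sqrtr_ge0.
move=> n.
have [|||ih eh] := @ftc R (fun y => - 2 * Num.sqrt (x - y))
  (fun y => (Num.sqrt `|x - y|)^-1) (x - 1) (x - n.+1%:R^-1).
- by rewrite lerD2l lerN2.
- move=> y /andP[_ xy].
  have yx : 0 < x - y by rewrite subr_gt0 (le_lt_trans xy)// gtrDl oppr_lt0.
  apply: (is_derive_eq (f' := - 2 * ((2 * Num.sqrt (x - y))^-1 * (0 - 1)) + Num.sqrt (x - y) * 0)).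
    by der.
  rewrite gtr0_norm// sub0r mulr0 addr0 invfM mulrN1 mulrNN mulrA divff ?mul1r//.
- move=> y /andP[_ xy].
  have yx : 0 < x - y by rewrite subr_gt0 (le_lt_trans xy)// gtrDl oppr_lt0.
  apply: cvgV; first by rewrite gt_eqF// sqrtr_gt0 gtr0_norm.
  apply: (cvg_comp (fun y => `|x - y|)); last exact: sqrt_continuous.
  by apply: cvg_norm; apply: cvgB => //; exact: cvg_cst.
rewrite -(fineK (integrable_fin_num _ ih))// -/(Rintegral _ _ _) [Rintegral _ _ _]eh lee_fin.
rewrite !subKr sqrtr1 mulr1 mulNr opprK.
by rewrite gerDr oppr_le0 mulr_ge0// sqrtr_ge0.
Qed.

Lemma measurable_oneDsqrV : measurable_fun [set: R] (fun y : R => (oneDsqr y)^-1).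
Proof. exact: (continuous_measurable_fun (@continuous_oneDsqrV R)). Qed.

Lemma integrable_oneDsqrV :
  mu.-integrable [set: R] (fun y => ((oneDsqr y)^-1)%:E) /\
  \int[mu]_y (oneDsqr y)^-1 = pi.
Proof.
have m1 : measurable_fun [set: R] (fun y : R => ((oneDsqr y)^-1)%:E).
  apply/measurable_EFinP; exact: measurable_oneDsqrV.
have E : (\int[mu]_y ((oneDsqr y)^-1)%:E = pi%:E)%E.
  rewrite ge0_symfun_integralT.
  - rewrite (_ : [set x | _] = `[0, +oo[%classic); last first.
      by apply/seteqP; split => x /=; rewrite in_itv /= andbT.
    by rewrite integral0y_oneDsqr -EFinM mulrC divfK.
  - by move=> x; rewrite invr_ge0.
  - exact: continuous_oneDsqrV.
  - by move=> x /=; rewrite /oneDsqr sqrrN.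
split; last by rewrite /Rintegral E.
apply/integrableP; split => //.
under eq_integral do rewrite gee0_abs ?lee_fin ?invr_ge0//.
by rewrite E ltry.
Qed.

(** Within distance 1 of [x] the weight is at most 1 and the singularity contributes 2 on either
    side; farther away the singularity is at most 1 and the weight contributes its mass [pi]. That
    the bound is uniform in [x] makes it a Schur test for the TT* kernel. *)
Lemma weight_convolution x :
  mu.-integrable [set: R] (fun y => ((oneDsqr y)^-1 * (Num.sqrt `|x - y|)^-1)%:E) /\
  \int[mu]_y ((oneDsqr y)^-1 * (Num.sqrt `|x - y|)^-1) <= pi + 4.
Proof.
have h0 y : 0 <= (Num.sqrt `|x - y|)^-1 by rewrite invr_ge0 sqrtr_ge0.
have W0 y : 0 <= (oneDsqr y)^-1 by rewrite invr_ge0.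
have W1 y : (oneDsqr y)^-1 <= 1 :> R by exact: oneDsqrV_le1.
have mW : measurable_fun [set: R] (fun y : R => (oneDsqr y)^-1).
  by apply: measurable_oneDsqrV.
have mWh : measurable_fun [set: R] (fun y => ((oneDsqr y)^-1 * (Num.sqrt `|x - y|)^-1)%:E).
  by apply/measurable_EFinP; apply: measurable_funM => //; apply/measurable_EFinP; exact: mh.
have E : (\int[mu]_y ((oneDsqr y)^-1 * (Num.sqrt `|x - y|)^-1)%:E <= (pi + 4)%:E)%E.
  pose D : set R := `[x - 1, x[ `|` `]x, x + 1].
  have mD : measurable D by exact: measurableU.
  apply: (@le_trans _ _ (\int[mu]_y (((oneDsqr y)^-1)%:E +
     ((fun y => ((Num.sqrt `|x - y|)^-1)%:E) \_ D) y))%E).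
    apply: ge0_le_integral => //.
    - apply: emeasurable_funD; first exact/measurable_EFinP.
      by apply/(measurable_restrictT _ _).1 => //; apply: measurable_funTS; exact: mh.
    - move=> y _; rewrite patchE; case: ifPn => yD.
        by rewrite -EFinD lee_fin (le_trans (ler_piMl _ (W1 y)))// lerDr.
      rewrite adde0 lee_fin ler_piMr//.
      have [->|xy] := eqVneq x y; first by rewrite subrr normr0 sqrtr0 invr0.
      have : 1 <= `|x - y|.
        rewrite leNgt; apply: contra yD; rewrite ltr_distl => /andP[h1 h2].
        rewrite inE /D /=; rewrite !in_itv /=.
        move: xy; rewrite neq_lt => /orP[] h; [right|left]; apply/andP; split; lra.
      move=> h; rewrite invf_le1 ?sqrtr_gt0 ?(lt_le_trans _ h)//.
      by rewrite -sqrtr1 ler_sqrt// (le_trans _ h).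
  rewrite ge0_integralD//.
  - rewrite EFinD; apply: leeD.
      rewrite -integrable_oneDsqrV.2 /Rintegral fineK//.
      exact: integrable_fin_num integrable_oneDsqrV.1.
    rewrite -integral_mkcond ge0_integral_setU//=.
    + rewrite (_ : 4 = 2 + 2); last by lra.
      by rewrite EFinD; apply: leeD; [exact: integral_sqrtV_left|exact: integral_sqrtV_right].
    + apply: measurable_funTS; exact: mh.
    + apply/disj_setPS => y [] /=; rewrite !in_itv /= => /andP[_ h1] /andP[h2 _].
      by have := lt_trans h1 h2; rewrite ltxx.
  - exact/measurable_EFinP.
  - by move=> y _; rewrite patchE; case: ifP => // _; rewrite lee_fin.
  - by apply/(measurable_restrictT _ _).1 => //; apply: measurable_funTS; exact: mh.
have I : mu.-integrable [set: R] (fun y => ((oneDsqr y)^-1 * (Num.sqrt `|x - y|)^-1)%:E).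
  apply/integrableP; split => //.
  under eq_integral do rewrite gee0_abs ?lee_fin ?mulr_ge0//.
  by rewrite (le_lt_trans E)// ltry.
split => //; rewrite -lee_fin /Rintegral fineK//.
exact: integrable_fin_num I.
Qed.
End SingularWeight.

(** * Oscillatory integrals over two-sided frequency bands *)

Section Band.
Context {R : realType}.
Local Notation mu := (@lebesgue_measure R).
Implicit Types (x y u s m M N xi : R).

(** Closed at [N], so that it is continuous from the right in [N]; open at [m], so that consecutive
    bands are disjoint. A negative [m] imposes no lower cut. *)
Definition band m N xi : R := if (m < `|xi|) && (`|xi| <= N) then 1 else 0.

Lemma band_ge0 m N xi : 0 <= band m N xi.
Proof. by rewrite /band; case: ifP. Qed.

Lemma band_le1 m N xi : band m N xi <= 1.
Proof. by rewrite /band; case: ifP. Qed.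

(** In the TT* kernel the truncations chosen at two points merge into one band, so the kernel bound
    applies whatever these choices are. *)
Lemma bandM m N M xi : band m N xi * band m M xi = band m (Num.min N M) xi.
Proof.
rewrite /band le_min; case: (m < `|xi|) => /=; last by rewrite mul0r.
by case: (`|xi| <= N); case: (`|xi| <= M); rewrite /= ?mulr1 ?mulr0.
Qed.

Let osc u s xi : R := cos (u * xi - s * xi ^+ 2) * (Num.sqrt `|xi|)^-1.

Let osc_cont u s m M : 0 < m -> {within `[m, M], continuous (osc u s)}.
Proof.
move=> m0; apply: continuous_in_subspaceT => x /set_mem; rewrite /= in_itv /= => /andP[mx _].
have x0 := lt_le_trans m0 mx.
apply: cvgM; first by simple notypeclasses refine (der_cont _); [|der].
apply: cvgV; first by rewrite gt_eqF// sqrtr_gt0 gtr0_norm.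
apply: (cvg_comp (fun y : R => `|y|)); last exact: sqrt_continuous.
by apply: cvg_norm; exact: cvg_id.
Qed.

Let osc_oppr u s xi : osc u s (- xi) = osc (- u) s xi.
Proof. by rewrite /osc normrN sqrrN mulrN mulNr. Qed.

Let osc_cont_oppr u s m M : 0 < m -> {within `[- M, - m], continuous (osc u s)}.
Proof.
move=> m0; apply: continuous_in_subspaceT => x /set_mem; rewrite /= in_itv /= => /andP[_ mx].
have x0 : x < 0 by rewrite (le_lt_trans mx)// oppr_lt0.
apply: cvgM; first by simple notypeclasses refine (der_cont _); [|der].
apply: cvgV; first by rewrite gt_eqF// sqrtr_gt0 normr_gt0 lt_eqF.
apply: (cvg_comp (fun y : R => `|y|)); last exact: sqrt_continuous.
by apply: cvg_norm; exact: cvg_id.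
Qed.

Let osc_bound u s m M : u != 0 -> 0 < m -> m <= M ->
  `|\int[mu]_(xi in `[m, M]) osc u s xi| <= osc_const * (Num.sqrt `|u|)^-1.
Proof.
move=> u0 m0 mM.
have E v r : (forall xi, cos (u * xi - s * xi ^+ 2) = cos (v * xi - r * xi ^+ 2)) ->
  \int[mu]_(xi in `[m, M]) osc u s xi =
  \int[mu]_(xi in `[m, M]) (cos (v * xi - r * xi ^+ 2) * (Num.sqrt xi)^-1).
  move=> h; apply: eq_Rintegral => x /set_mem; rewrite /= in_itv /= => /andP[mx _].
  by rewrite /osc h ger0_norm// (le_trans _ mx)// ltW.
have := u0; rewrite neq_lt => /orP[un|up].
  rewrite (E (- u) (- s)); first by rewrite (ltr0_norm un) oscillatory_integral_bound// oppr_gt0.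
  by move=> x; rewrite -cosN; congr cos; ring.
by rewrite (E u s)// (gtr0_norm up) oscillatory_integral_bound.
Qed.

(** The factor 2 counts the two halves of the band; reflecting the negative half only replaces [u]
    by [- u]. *)
Lemma band_oscillatory_bound u s m N : u != 0 -> 0 < m ->
  `|\int[mu]_xi (band m N xi * (Num.sqrt `|xi|)^-1 * cos (u * xi - s * xi ^+ 2))|
  <= 2 * osc_const * (Num.sqrt `|u|)^-1.
Proof.
move=> u0 m0.
have r0 : 0 <= osc_const * (Num.sqrt `|u|)^-1.
  by rewrite mulr_ge0 ?osc_const_ge0// invr_ge0 sqrtr_ge0.
have [Nm|mN] := leP N m.
  under eq_Rintegral => xi _.
    rewrite /band (_ : _ && _ = false) ?mul0r; last first.
      by apply/negbTE/negP => /andP[h1 h2]; have := lt_le_trans h1 (le_trans h2 Nm); rewrite ltxx.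
    over.
  by rewrite Rintegral_cst// mul0r normr0 -mulrA mulr_ge0.
pose D : set R := `[- N, - m[ `|` `]m, N].
have mD : measurable D by exact: measurableU.
have DE xi : (xi \in D) = (m < `|xi|) && (`|xi| <= N).
  apply/idP/idP.
    move/set_mem; rewrite /D /= !in_itv /= => -[] /andP[h1 h2].
      by rewrite ltr0_norm ?(lt_le_trans h2) ?oppr_le0 ?(ltW m0)//; apply/andP; split; lra.
    by rewrite gtr0_norm ?(lt_trans m0)// h1.
  move=> /andP[h1 h2]; apply/mem_set; rewrite /D /= !in_itv /=.
  move: h1 h2; case: (ltrP 0 xi) => xi0.
    by rewrite gtr0_norm// => -> ->; right.
  by rewrite ler0_norm// => h1 h2; left; apply/andP; split; lra.
have i1 : mu.-integrable `[m, N] (EFin \o osc u s).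
  by apply: continuous_compact_integrable; [exact: segment_compact|exact: osc_cont].
have i2 : mu.-integrable `[- N, - m] (EFin \o osc u s).
  by apply: continuous_compact_integrable; [exact: segment_compact|exact: osc_cont_oppr].
have i1' : mu.-integrable `]m, N] (EFin \o osc u s).
  by apply: integrableS i1 => //; apply: subset_itvr; rewrite bnd_simp.
have i2' : mu.-integrable `[- N, - m[ (EFin \o osc u s).
  by apply: integrableS i2 => //; apply: subset_itvl; rewrite bnd_simp.
have dis : [disjoint `[- N, - m[ & `]m, N]].
  apply/disj_setPS => y [] /=; rewrite !in_itv /= => /andP[_ h1] /andP[h2 _].
  by lra.
have iD : mu.-integrable D (EFin \o osc u s).
  have mf : measurable_fun D (EFin \o osc u s).
    by apply/measurable_funU => //; split; [exact: measurable_int i2'|exact: measurable_int i1'].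
  apply/integrableP; split => //; rewrite ge0_integral_setU//.
    apply: lte_add_pinfty.
      by case/integrableP : i2'.
    by case/integrableP : i1'.
  exact: measurableT_comp.
rewrite (_ : Rintegral _ _ _ = \int[mu]_(xi in D) osc u s xi); last first.
  rewrite [RHS]Rintegral_mkcond; apply: eq_Rintegral => xi _.
  by rewrite patchE DE /band /osc; case: ifP; rewrite ?mul0r// mul1r mulrC.
rewrite Rintegral_setU//.
rewrite Rintegral_itv_bndo_bndc// Rintegral_itv_obnd_cbnd//.
rewrite {1}/Rintegral integration_by_substitution_oppr; [|exact: ltW|exact: osc_cont_oppr].
rewrite -/(Rintegral _ _ _) (le_trans (ler_normD _ _))// -mulrA mulr_natl mulr2n.
rewrite lerD ?osc_bound ?(ltW mN)//.
rewrite (_ : Rintegral _ _ _ = \int[mu]_(xi in `[m, N]) osc (- u) s xi).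
  by rewrite -(normrN u) osc_bound ?oppr_eq0// ltW.
by apply: eq_Rintegral => x _; rewrite -osc_oppr.
Qed.
End Band.

(** * The linearized maximal operator *)

Section TTstar.
Context {R : realType}.
Local Notation mu := (@lebesgue_measure R).

(** With [cos] and [sin] for [T], the real and imaginary parts of the truncated kernel
    [exp (i (x xi - t xi^2))]. An abstract bounded [T] lets one Fubini argument cover both. *)
Definition wave (T : R -> R) (m N t x xi : R) : R :=
  band m N xi * T (x * xi - t * xi ^+ 2).

Lemma integrable_oneDsqrVM (f : R -> R) : measurable_fun [set: R] f ->
  (forall x, `|f x| <= (oneDsqr x)^-1) -> mu.-integrable [set: R] (EFin \o f).
Proof.
move=> mf fW; apply: (le_integrable _ _ _ integrable_oneDsqrV.1) => //.
  exact/measurable_EFinP.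
by move=> x _; rewrite /= lee_fin (le_trans (fW x))// ler_norm.
Qed.

Lemma measurable_band (m L : R) : measurable_fun [set: R] (band m L).
Proof.
apply: measurable_fun_ifT => //; apply: measurable_and; first exact: measurable_fun_ltr.
exact: measurable_fun_ler.
Qed.

Lemma integrable_band (m L : R) : mu.-integrable [set: R] (EFin \o band m L).
Proof.
have iD : mu.-integrable [set: R] (EFin \o \1_(`[- L, L] : set R)) by exact: integrable_indic_itv.
apply: (le_integrable _ _ _ iD) => //; first by apply/measurable_EFinP; exact: measurable_band.
move=> x _; rewrite /= lee_fin /band indicE; case: ifP => [/andP[_]|_]; last by rewrite normr0.
rewrite ler_norml => h; have -> : (x \in `[- L, L]%classic) = true by apply/mem_set; rewrite /= in_itv.
exact: lexx.
Qed.

Lemma normr_wave (T : R -> R) m N L t x xi : (forall u, `|T u| <= 1) -> N <= L ->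
  `|wave T m N t x xi| <= band m L xi.
Proof.
move=> T1 NL; rewrite /wave /band; case: ifP => [/andP[-> h]|_]; last first.
  by rewrite mul0r normr0; case: ifP.
by rewrite (le_trans h NL) mul1r.
Qed.

Lemma measurable_wave (T t N : R -> R) m : measurable_fun [set: R] T ->
  measurable_fun [set: R] t -> measurable_fun [set: R] N ->
  measurable_fun [set: R * R] (fun z : R * R => wave T m (N z.1) (t z.1) z.1 z.2).
Proof.
move=> mT mt mN; apply: measurable_funM.
  apply: measurable_fun_ifT => //; apply: measurable_and.
    by apply: measurable_fun_ltr => //; exact: measurableT_comp.
  by apply: measurable_fun_ler => //; exact: measurableT_comp.
apply: (measurableT_comp mT); apply: measurable_funB; first exact: measurable_funM.
by apply: measurable_funM; [exact: measurableT_comp|exact: measurable_funX].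
Qed.

(** Meant for the TT* kernel, whose bound [|x - y|^(-1/2)] is meaningless on the diagonal: there
    [(Num.sqrt 0)^-1] evaluates to 0. *)
Lemma le_Rintegral_off1 (f g : R -> R) (x : R) :
  mu.-integrable [set: R] (EFin \o f) -> mu.-integrable [set: R] (EFin \o g) ->
  (forall y, y != x -> f y <= g y) -> \int[mu]_y f y <= \int[mu]_y g y.
Proof.
move=> jf jg fg.
have mD : measurable (setT `\ x : set R) by apply: measurableD.
have E h : mu.-integrable [set: R] (EFin \o h) ->
    \int[mu]_(y in setT `\ x) h y = \int[mu]_y h y.
  move=> jh; rewrite /Rintegral integral_setD1//.
  by apply: measurable_funTS; exact: measurable_int jh.
rewrite -(E _ jf) -(E _ jg); apply: le_Rintegral => //.
- by apply: integrableS jf.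
- by apply: integrableS jg.
- by move=> y [_ /= /eqP]; exact: fg.
Qed.

Section Linearized.
Context (m L : R) (t N w : R -> R).
Hypotheses (mt : measurable_fun [set: R] t)
  (mN : measurable_fun [set: R] N) (mw : measurable_fun [set: R] w)
  (NL : forall x, N x <= L) (wW : forall x, `|w x| <= (oneDsqr x)^-1).

(* [t] and [N] are the measurable choices of time and truncation made at each
   point [x], and [w] is a signed weight. *)
Definition adj (T : R -> R) xi := \int[mu]_x (w x * wave T m (N x) (t x) x xi).

Section OneTrig.
Context (T : R -> R) (mT : measurable_fun [set: R] T) (T1 : forall u, `|T u| <= 1).

Let wb x xi : `|w x * wave T m (N x) (t x) x xi| <= (oneDsqr x)^-1 * band m L xi.
Proof. by rewrite normrM ler_pM// normr_wave. Qed.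

Let mww : measurable_fun [set: R * R] (fun z : R * R => w z.1 * wave T m (N z.1) (t z.1) z.1 z.2).
Proof. by apply: measurable_funM; [exact: measurableT_comp|exact: measurable_wave]. Qed.

Lemma measurable_adj : measurable_fun [set: R] (adj T).
Proof.
have ik := integrable_prod mww integrable_oneDsqrV.1 (integrable_band m L) wb.
have [_ /measurable_int h _] := Rintegral_fubini ik.
exact/measurable_EFinP.
Qed.

Lemma normr_adj xi : `|adj T xi| <= pi * band m L xi.
Proof.
have ms : measurable_fun [set: R] (fun x => w x * wave T m (N x) (t x) x xi).
  exact: (measurableT_comp mww (measurable_pair2 _)).
have b1 x : `|w x * wave T m (N x) (t x) x xi| <= (oneDsqr x)^-1.
  by rewrite (le_trans (wb _ _))// ler_piMr ?invr_ge0 ?band_le1.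
have is_ := integrable_oneDsqrVM ms b1.
apply: (le_trans (le_normr_Rintegral _ is_)) => //.
rewrite -integrable_oneDsqrV.2 -RintegralZr//; last exact: integrable_oneDsqrV.1.
apply: le_Rintegral => //.
- exact: integrable_norm.
- have := integrableZr measurableT (band m L xi) integrable_oneDsqrV.1.
  by apply: eq_integrable.
Qed.

(** Fubini's theorem; the double integrand is dominated by the weight in [x] times [|h|] on the band
    in [xi]. It makes [adj] the transpose of the linearized operator. *)
Lemma adj_duality (h : R -> R) : measurable_fun [set: R] h ->
  mu.-integrable [set: R] (fun xi => (h xi * band m L xi)%:E) ->
  [/\ mu.-integrable [set: R] (fun xi => (h xi * adj T xi)%:E),
      mu.-integrable [set: R] (fun x => (w x * \int[mu]_xi (h xi * wave T m (N x) (t x) x xi))%:E) &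
  \int[mu]_xi (h xi * adj T xi) =
  \int[mu]_x (w x * \int[mu]_xi (h xi * wave T m (N x) (t x) x xi))].
Proof.
move=> mh ih.
pose k (z : R * R) := h z.2 * (w z.1 * wave T m (N z.1) (t z.1) z.1 z.2).
have mk : measurable_fun [set: R * R] k.
  by apply: measurable_funM => //; exact: measurableT_comp.
have e1 xi : \int[mu]_x k (x, xi) = h xi * adj T xi.
  rewrite /k /= RintegralZl//.
  have b1 x : `|w x * wave T m (N x) (t x) x xi| <= (oneDsqr x)^-1.
    by rewrite (le_trans (wb _ _))// ler_piMr ?invr_ge0 ?band_le1.
  apply: integrable_oneDsqrVM b1.
  exact: (measurableT_comp mww (measurable_pair2 _)).
have e2 x : \int[mu]_xi k (x, xi) = w x * \int[mu]_xi (h xi * wave T m (N x) (t x) x xi).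
  rewrite /k /= -RintegralZl//; first by apply: eq_Rintegral => xi _; rewrite mulrCA.
  apply: (le_integrable _ _ _ ih) => //.
    apply/measurable_EFinP; apply: measurable_funM => //.
    exact: (measurableT_comp (measurable_wave m mT mt mN) (pair1_measurable x)).
  move=> xi _; rewrite /= lee_fin normrM (normrM (h xi) (band _ _ _)) ler_wpM2l//.
  by rewrite (ger0_norm (band_ge0 _ _ _)) normr_wave.
have ik : (mu \x mu)%E.-integrable [set: R * R] (EFin \o k).
  apply: (integrable_prod mk integrable_oneDsqrV.1 (integrable_norm ih)) => x xi.
  rewrite /k /= normrM (normrM (h xi)) [leRHS]mulrCA ler_wpM2l//.
  by rewrite (ger0_norm (band_ge0 _ _ _)).
have [i1 i2 e] := Rintegral_fubini ik.
split.
- apply: eq_integrable i2; [exact: measurableT|move=> xi _]; congr EFin; exact: e1.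
- apply: eq_integrable i1; [exact: measurableT|move=> x _]; congr EFin; exact: e2.
- under eq_Rintegral do rewrite -e1.
  under [RHS]eq_Rintegral do rewrite -e2.
  exact: esym e.
Qed.

End OneTrig.

Hypothesis m1 : 1 <= m.

Let v (xi : R) : R := (Num.sqrt `|xi|)^-1.

Let v_ge0 xi : 0 <= v xi. Proof. by rewrite invr_ge0 sqrtr_ge0. Qed.

Let vband xi : v xi * band m L xi <= band m L xi.
Proof.
rewrite /band; case: ifP => [/andP[h _]|_]; last by rewrite mulr0.
have h1 : 1 <= `|xi| by rewrite ltW// (le_lt_trans m1).
rewrite mulr1 invf_le1 ?sqrtr_gt0 ?(lt_le_trans _ h1)//.
by rewrite -sqrtr1 ler_sqrt// (le_trans _ h1).
Qed.

Let vbounded (g : R -> R) : measurable_fun [set: R] g ->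
  (forall xi, `|g xi| <= v xi * (pi * band m L xi)) ->
  mu.-integrable [set: R] (EFin \o g).
Proof.
move=> mg gb; apply: (le_integrable _ _ _ (integrableZl measurableT pi (integrable_band m L))) => //.
  exact/measurable_EFinP.
move=> xi _; rewrite /= lee_fin (le_trans (gb xi))// mulrCA.
rewrite (le_trans _ (ler_norm _))// ler_wpM2l ?pi_ge0//; exact: vband.
Qed.

(** Kernel bound, times its integral against the weight, times the mass [pi] of the weight in the
    outer variable. *)
Definition tt_const : R := 2 * osc_const * (pi + 4) * pi.

Let K0 : R := 2 * osc_const * (pi + 4).

Let mv : measurable_fun [set: R] v.
Proof. exact: measurable_sqrtV. Qed.

Let measurable_slice (T : R -> R) (mT : measurable_fun [set: R] T) x :
  measurable_fun [set: R] (wave T m (N x) (t x) x).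
Proof. exact: (measurableT_comp (measurable_wave m mT mt mN) (pair1_measurable x)). Qed.

Let integrable_vslice (T : R -> R) (mT : measurable_fun [set: R] T)
  (T1 : forall u, `|T u| <= 1) x :
  mu.-integrable [set: R] (fun xi => (v xi * wave T m (N x) (t x) x xi * band m L xi)%:E).
Proof.
apply: (le_integrable _ _ _ (integrable_band m L)) => //.
  apply/measurable_EFinP; apply: measurable_funM; last exact: measurable_band.
  by apply: measurable_funM => //; exact: measurable_slice.
move=> xi _; rewrite /= lee_fin mulrAC normrM.
rewrite (le_trans _ (ler_norm _))// (@le_trans _ _ (band m L xi * band m L xi))//.
  rewrite ler_pM// ?normr_wave// ger0_norm ?mulr_ge0 ?band_ge0//; exact: vband.
by rewrite ler_piMr ?band_le1 ?band_ge0.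
Qed.

Let integrable_vadj (T : R -> R) (mT : measurable_fun [set: R] T)
  (T1 : forall u, `|T u| <= 1) :
  mu.-integrable [set: R] (fun xi => (v xi * adj T xi * band m L xi)%:E).
Proof.
apply: vbounded => [|xi].
  apply: measurable_funM; last exact: measurable_band.
  by apply: measurable_funM => //; exact: measurable_adj.
rewrite -mulrA normrM (ger0_norm (v_ge0 _)) ler_wpM2l// normrM.
rewrite (@le_trans _ _ (pi * band m L xi * 1))//; last by rewrite mulr1.
by rewrite ler_pM// ?normr_adj// ger0_norm ?band_ge0// band_le1.
Qed.

Let inner (T : R -> R) x := \int[mu]_xi (v xi * adj T xi * wave T m (N x) (t x) x xi).

(** Expanding [adj] by duality puts [w y] against the TT* kernel. Adding the cosine and sine parts
    gives the cosine of the difference of the two phases, hence an oscillatory integral with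
    parameters [x - y] and [t x - t y]; as its bound ignores the second one, nothing is asked of [t]
    beyond measurability. *)
Let inner_bound x : `|inner cos x + inner sin x| <= K0.
Proof.
pose F (T : R -> R) y := \int[mu]_xi (v xi * wave T m (N x) (t x) x xi * wave T m (N y) (t y) y xi).
have EF (T : R -> R) (mT : measurable_fun [set: R] T) (T1 : forall u, `|T u| <= 1) :
    mu.-integrable [set: R] (fun y => (w y * F T y)%:E) /\
    inner T x = \int[mu]_y (w y * F T y).
  have [||_ h1 h2] := adj_duality mT T1 (h := fun xi => v xi * wave T m (N x) (t x) x xi).
  - by apply: measurable_funM => //; exact: measurable_slice.
  - exact: integrable_vslice.
  split; first exact: h1.
  by rewrite -h2; apply: eq_Rint => xi; rewrite mulrAC.
have [ic ec] := EF _ (@measurable_cos R) (@cos_bound R).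
have [is_ es] := EF _ (@measurable_sin R) (@sin_bound R).
rewrite ec es -(RintD ic is_).
have iD := intD ic is_.
apply: (le_trans (le_normr_Rintegral _ iD)) => //.
have [iW W4] := weight_convolution x.
have o0 : 0 <= 2 * osc_const :> R by rewrite mulr_ge0// osc_const_ge0.
apply: (@le_trans _ _ (2 * osc_const * \int[mu]_y ((oneDsqr y)^-1 * (Num.sqrt `|x - y|)^-1))); last first.
  by rewrite ler_wpM2l.
rewrite -RintegralZl//; apply: (le_Rintegral_off1 (x := x)).
- exact: integrable_norm.
- by have := integrableZl measurableT (2 * osc_const) iW; apply: eq_integrable.
move=> y yx; rewrite -mulrDr normrM mulrCA ler_pM//.
have ivw (T : R -> R) (mT : measurable_fun [set: R] T) (T1 : forall u, `|T u| <= 1) :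
    mu.-integrable [set: R]
      (fun xi => (v xi * wave T m (N x) (t x) x xi * wave T m (N y) (t y) y xi)%:E).
  apply: (le_integrable _ _ _ (integrable_vslice mT T1 x)) => //.
    apply/measurable_EFinP; apply: measurable_funM; last exact: measurable_slice.
    by apply: measurable_funM => //; exact: measurable_slice.
  move=> xi _; rewrite /= lee_fin normrM [leRHS]normrM ler_wpM2l//.
  by rewrite (ger0_norm (band_ge0 _ _ _)) normr_wave.
rewrite /F -RintegralD//; [|exact: ivw (@measurable_cos R) (@cos_bound R)|
  exact: ivw (@measurable_sin R) (@sin_bound R)].
have xy : x - y != 0 by rewrite subr_eq0 eq_sym.
have m0 : 0 < m by exact: lt_le_trans m1.
rewrite (le_trans _ (band_oscillatory_bound (t x - t y) (Num.min (N x) (N y)) xy m0))//.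
rewrite le_eqVlt; apply/orP; left; apply/eqP; congr (`|_|); apply: eq_Rintegral => xi _.
rewrite -bandM /wave.
set c := band _ _ _; set d := band _ _ _; rewrite -/(v xi).
have -> : (x - y) * xi - (t x - t y) * xi ^+ 2 =
  (x * xi - t x * xi ^+ 2) - (y * xi - t y * xi ^+ 2) by ring.
by rewrite [in RHS]cosB; ring.
Qed.

(** By duality the left side is the integral of [w] against [inner cos + inner sin], and the latter
    is bounded by [K0]. Since [v] is [|xi|^(-1/2)], this bounds the adjoint in the homogeneous
    [H^(-1/4)], dual to the quarter of a derivative available in the second regime. *)
Lemma TTstar_bound :
  mu.-integrable [set: R] (fun xi => (v xi * (adj cos xi ^+ 2 + adj sin xi ^+ 2))%:E) /\
  \int[mu]_xi (v xi * (adj cos xi ^+ 2 + adj sin xi ^+ 2)) <= tt_const.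
Proof.
have [||h1 h2 h3] := adj_duality (@measurable_cos R) (@cos_bound R) (h := fun xi => v xi * adj cos xi).
- apply: measurable_funM; [exact: mv|exact: measurable_adj].
- exact: integrable_vadj.
have [||k1 k2 k3] := adj_duality (@measurable_sin R) (@sin_bound R) (h := fun xi => v xi * adj sin xi).
- apply: measurable_funM; [exact: mv|exact: measurable_adj].
- exact: integrable_vadj.
have E xi : v xi * (adj cos xi ^+ 2 + adj sin xi ^+ 2) =
  v xi * adj cos xi * adj cos xi + v xi * adj sin xi * adj sin xi by ring.
split; first exact: (eq_int (fun xi => esym (E xi)) (intD h1 k1)).
rewrite (eq_Rint E) (RintD h1 k1) h3 k3 -(RintD h2 k2).
have -> : tt_const = K0 * \int[mu]_x (oneDsqr x)^-1 by rewrite integrable_oneDsqrV.2.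
apply: (le_trans (ler_norm _)).
rewrite -(RintZ _ integrable_oneDsqrV.1).
apply: (normr_Rint (intD h2 k2) (intZ _ integrable_oneDsqrV.1)) => x.
rewrite -mulrDr normrM mulrC.
apply: ler_pM; [exact: normr_ge0|exact: normr_ge0|exact: inner_bound|exact: wW].
Qed.

End Linearized.
End TTstar.

(** * The weighted bound for the linearized operator on data of density [D] *)

Section LinearizedMaximal.
Context {R : realType}.
Local Notation mu := (@lebesgue_measure R).

Section Density.
Context (a b D : R -> R).
Hypotheses (ma : measurable_fun [set: R] a) (mb : measurable_fun [set: R] b)
  (iD : mu.-integrable [set: R] (EFin \o D)) (D0 : forall xi, 0 <= D xi)
  (abD : forall xi, (`|a xi| <= D xi /\ `|b xi| <= D xi) \/
    (a xi ^+ 2 + b xi ^+ 2 <= D xi /\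
     (a xi ^+ 2 + b xi ^+ 2) * Num.sqrt `|xi| <= D xi)).

(** In the second regime this is [|c| <= 1 + c^2]. It makes the transform integrable on every band,
    which justifies all applications of Fubini's theorem and of dominated convergence. *)
Lemma density_bound xi : `|a xi| <= 1 + D xi /\ `|b xi| <= 1 + D xi.
Proof.
have h (c : R) : c ^+ 2 <= D xi -> `|c| <= 1 + D xi.
  move=> cD; apply: (@le_trans _ _ (1 + c ^+ 2)); last by rewrite lerD2l.
  by rewrite ler_norml; apply/andP; split; nra.
case: (abD xi) => -[h1 h2].
  by split; [apply: (le_trans h1)|apply: (le_trans h2)]; rewrite lerDr.
by split; apply: h; apply: le_trans h1; rewrite ?lerDl ?lerDr sqr_ge0.
Qed.

Lemma integrable_density_band (c : R -> R) m L : measurable_fun [set: R] c ->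
  (forall xi, `|c xi| <= 1 + D xi) ->
  mu.-integrable [set: R] (fun xi => (c xi * band m L xi)%:E).
Proof.
move=> mc cD; apply: (le_integrable _ _ _ (integrableD measurableT (integrable_band m L) iD)) => //.
  by apply/measurable_EFinP; apply: measurable_funM => //; exact: measurable_band.
move=> xi _; rewrite /= lee_fin normrM (ger0_norm (band_ge0 _ _ _)).
rewrite (le_trans _ (ler_norm _))//.
have := band_le1 m L xi; have := band_ge0 m L xi; have := cD xi; have := D0 xi; have := normr_ge0 (c xi).
nra.
Qed.

(* For [g = a + i b], the real part of the integral of
   [exp(i(x xi - t xi^2)) g(xi)] over the band; its imaginary part is
   [osum b (- a)]. *)
Definition osum m N t x :=
  \int[mu]_xi (a xi * wave cos m N t x xi - b xi * wave sin m N t x xi).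

Definition tail m := \int[mu]_xi (if m < `|xi| then D xi else 0).

Lemma integrable_tail m :
  mu.-integrable [set: R] (fun xi => (if m < `|xi| then D xi else 0)%:E).
Proof.
apply: (le_integrable _ _ _ iD) => //.
  apply/measurable_EFinP; apply: measurable_fun_ifT => //.
    by apply: measurable_fun_ltr => //; exact: measurableT_comp.
  by apply/measurable_EFinP; exact: measurable_int iD.
by move=> xi _; rewrite /= lee_fin; case: ifP => _ //; rewrite normr0.
Qed.

Lemma integrable_wave (T c : R -> R) m N t x : measurable_fun [set: R] T ->
  (forall u, `|T u| <= 1) -> measurable_fun [set: R] c ->
  (forall xi, `|c xi| <= 1 + D xi) ->
  mu.-integrable [set: R] (fun xi => (c xi * wave T m N t x xi)%:E).
Proof.
move=> mT T1 mc cD; apply: (le_integrable _ _ _ (integrable_density_band m N mc cD)) => //.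
  apply/measurable_EFinP; apply: measurable_funM => //.
  exact: (measurableT_comp (measurable_wave m mT (measurable_cst t) (measurable_cst N)) (pair1_measurable x)).
move=> xi _; rewrite /= lee_fin normrM [leRHS]normrM ler_wpM2l//.
by rewrite (ger0_norm (band_ge0 _ _ _)) normr_wave.
Qed.

Section Linearized.
Context (m L : R) (t N w : R -> R).
Hypotheses (m1 : 1 <= m) (mt : measurable_fun [set: R] t)
  (mN : measurable_fun [set: R] N) (mw : measurable_fun [set: R] w)
  (NL : forall x, N x <= L) (wW : forall x, `|w x| <= (oneDsqr x)^-1).

Lemma integrable_osum :
  mu.-integrable [set: R] (fun x => (w x * osum m (N x) (t x) x)%:E) /\
  \int[mu]_x (w x * osum m (N x) (t x) x) =
  \int[mu]_xi (a xi * adj m t N w cos xi - b xi * adj m t N w sin xi).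
Proof.
have ia := integrable_density_band m L ma (fun xi => (density_bound xi).1).
have ib := integrable_density_band m L mb (fun xi => (density_bound xi).2).
have E x : w x * osum m (N x) (t x) x =
   w x * (\int[mu]_xi (a xi * wave cos m (N x) (t x) x xi)) -
   w x * (\int[mu]_xi (b xi * wave sin m (N x) (t x) x xi)).
  rewrite -mulrBr -RintB//.
    by apply: integrable_wave => // xi; exact: (density_bound xi).1.
  by apply: integrable_wave => // xi; exact: (density_bound xi).2.
have [a1 a2 a3] := adj_duality mt mN mw NL wW (@measurable_cos R) (@cos_bound R) ma ia.
have [b1 b2 b3] := adj_duality mt mN mw NL wW (@measurable_sin R) (@sin_bound R) mb ib.
split; first exact: (eq_int (fun x => esym (E x)) (intB a2 b2)).
by rewrite (eq_Rint E) (RintB a2 b2) (RintB a1 b1) a3 b3.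
Qed.

(** The two alternatives of [abD] are treated pointwise. In the first, [|adj| <= pi] leaves
    [2 pi D]. In the second, [|c C| <= l c^2 sqrt |xi| + l^-1 C^2 / sqrt |xi|]: [D] controls the
    first term, [TTstar_bound] the integral of the second. *)
Lemma linearized_bound (l : R) : 0 < l ->
  `|\int[mu]_x (w x * osum m (N x) (t x) x)| <=
  (2 * pi + l) * tail m + l^-1 * tt_const.
Proof.
move=> l0; have [_ ->] := integrable_osum.
have ia := integrable_density_band m L ma (fun xi => (density_bound xi).1).
have ib := integrable_density_band m L mb (fun xi => (density_bound xi).2).
have nA := normr_adj m mt mN mw NL wW (@measurable_cos R) (@cos_bound R).
have nB := normr_adj m mt mN mw NL wW (@measurable_sin R) (@sin_bound R).
have [iQ Qb] := TTstar_bound mt mN mw NL wW m1.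
have [a1 _ _] := adj_duality mt mN mw NL wW (@measurable_cos R) (@cos_bound R) ma ia.
have [b1 _ _] := adj_duality mt mN mw NL wW (@measurable_sin R) (@sin_bound R) mb ib.
have jT := integrable_tail m.
have i1 := intZ (2 * pi + l) jT.
have i2 := intZ l^-1 iQ.
have li : 0 < l^-1 by rewrite invr_gt0.
have <- : \int[mu]_xi ((2 * pi + l) * (if m < `|xi| then D xi else 0)) = (2 * pi + l) * tail m.
  exact: (RintZ _ jT).
apply: (@le_trans _ _ (\int[mu]_xi ((2 * pi + l) * (if m < `|xi| then D xi else 0) +
   l^-1 * ((Num.sqrt `|xi|)^-1 *
   (adj m t N w cos xi ^+ 2 + adj m t N w sin xi ^+ 2))))); last first.
  rewrite (RintD i1 i2) lerD2l (RintZ _ iQ).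
  by apply: ler_wpM2l; [exact: ltW|exact: Qb].
apply: (normr_Rint (intB a1 b1) (intD i1 i2)) => xi.
move: (nA xi) (nB xi) => {nA nB iQ Qb a1 b1 jT i1 i2 ia ib}.
move: (adj m t N w cos xi) (adj m t N w sin xi) => A B.
have pi0 := pi_ge0 R; have D0xi := D0 xi.
have r0 := sqrtr_ge0 `|xi|.
case: ifPn => mxi; last first.
  rewrite /band (negbTE mxi) /= mulr0 !normr_le0 => /eqP -> /eqP ->.
  by rewrite !mulr0 subrr normr0 expr0n /= addr0 !mulr0 addr0.
move=> Ab Bb.
have {}Ab : `|A| <= pi by rewrite (le_trans Ab)// ler_piMr ?band_le1.
have {}Bb : `|B| <= pi by rewrite (le_trans Bb)// ler_piMr ?band_le1.
have {}r0 : 0 < Num.sqrt `|xi|.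
  by rewrite sqrtr_gt0 (lt_trans _ mxi)// (lt_le_trans _ m1).
case: (abD xi) => -[h1 h2].
  apply: (@le_trans _ _ ((2 * pi + l) * D xi)); last first.
    by rewrite lerDl mulr_ge0 ?(ltW li)// mulr_ge0 ?invr_ge0 ?(ltW r0)// addr_ge0 ?sqr_ge0.
  rewrite (le_trans (ler_normB _ _))// !normrM.
  have : `|a xi| * `|A| <= D xi * pi by rewrite ler_pM.
  have : `|b xi| * `|B| <= D xi * pi by rewrite ler_pM.
  have : 0 <= l * D xi by rewrite mulr_ge0// ltW.
  by lra.
have amgm (c C : R) : `|c * C| <= l * (c ^+ 2 * Num.sqrt `|xi|) + l^-1 * ((Num.sqrt `|xi|)^-1 * C ^+ 2).
  move: (Num.sqrt _) r0 => r r0.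
  rewrite -(ler_pM2l (mulr_gt0 l0 r0)).
  have -> : l * r * (l * (c ^+ 2 * r) + l^-1 * (r^-1 * C ^+ 2)) = (l * r * c) ^+ 2 + C ^+ 2.
    by field; rewrite !gt_eqF.
  rewrite -{1}(gtr0_norm (mulr_gt0 l0 r0)) -normrM mulrA ler_norml.
  move: (l * r * c) => e; apply/andP; split; nra.
rewrite (le_trans (ler_normB _ _))//.
apply: (le_trans (lerD (amgm _ _) (amgm _ _))).
have : l * ((a xi ^+ 2 + b xi ^+ 2) * Num.sqrt `|xi|) <= l * D xi by rewrite ler_wpM2l// ltW.
have : 0 <= pi * D xi by rewrite mulr_ge0.
by lra.
Qed.

End Linearized.
End Density.
End LinearizedMaximal.

(** * Maximal functions of the tails *)

Section MaximalSelection.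
Context {R : realType}.
Local Notation mu := (@lebesgue_measure R).

Section Density.
Context (a b D : R -> R).
Hypotheses (ma : measurable_fun [set: R] a) (mb : measurable_fun [set: R] b)
  (iD : mu.-integrable [set: R] (EFin \o D)) (D0 : forall xi, 0 <= D xi)
  (abD : forall xi, (`|a xi| <= D xi /\ `|b xi| <= D xi) \/
    (a xi ^+ 2 + b xi ^+ 2 <= D xi /\
     (a xi ^+ 2 + b xi ^+ 2) * Num.sqrt `|xi| <= D xi)).

Let osum := (@osum R a b).

Let wave_cvg (T : R -> R) m t N x xi (tk Nk : nat -> R) : continuous T ->
  tk k @[k --> \oo] --> t -> Nk k @[k --> \oo] --> N -> (forall k, N <= Nk k) ->
  wave T m (Nk k) (tk k) x xi @[k --> \oo] --> wave T m N t x xi.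
Proof.
move=> cT tkt NkN NNk; apply: cvgM; last first.
  apply: continuous_cvg; first exact: cT.
  by apply: cvgB; [exact: cvg_cst|apply: cvgM => //; exact: cvg_cst].
apply: cvg_near_cst; rewrite /band.
have [xN|Nx] := leP `|xi| N; first by apply: nearW => k; rewrite (le_trans xN).
have : \forall k \near \oo, Nk k < `|xi| by exact: (cvgr_lt N).
by apply: filterS => k h; rewrite leNgt h.
Qed.

(** The truncation is approached from above because a band is closed at [N]; the band ending at
    [N + 1] provides a common majorant. *)
Lemma osum_right_continuous m t N x (tk Nk : nat -> R) :
  tk k @[k --> \oo] --> t -> Nk k @[k --> \oo] --> N ->
  (forall k, N <= Nk k <= N + 1) ->
  osum m (Nk k) (tk k) x @[k --> \oo] --> osum m N t x.
Proof.
move=> tkt NkN NNk.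
have NNk1 k : N <= Nk k by case/andP: (NNk k).
have NNk2 k : Nk k <= N + 1 by case/andP: (NNk k).
have m1D : measurable_fun [set: R] (fun xi => 1 + D xi).
  by apply: measurable_funD; [exact: measurable_cst|exact: int_meas].
have D1 xi : `|1 + D xi| <= 1 + D xi by rewrite ger0_norm// addr_ge0.
have ig := intZ 2 (integrable_density_band iD D0 m (N + 1) m1D D1).
pose F k xi := a xi * wave cos m (Nk k) (tk k) x xi - b xi * wave sin m (Nk k) (tk k) x xi.
suff [_ h] : mu.-integrable [set: R]
    (EFin \o (fun xi => a xi * wave cos m N t x xi - b xi * wave sin m N t x xi)) /\
    \int[mu]_xi F k xi @[k --> \oo] --> osum m N t x by exact: h.
apply: (Rint_cvg _ _ ig).
- move=> k; apply: measurable_funB; apply: measurable_funM => //.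
    exact: (measurableT_comp (measurable_wave m (@measurable_cos R) (measurable_cst (tk k))
      (measurable_cst (Nk k))) (pair1_measurable x)).
  exact: (measurableT_comp (measurable_wave m (@measurable_sin R) (measurable_cst (tk k))
      (measurable_cst (Nk k))) (pair1_measurable x)).
- move=> xi; apply: cvgB; apply: cvgM; try exact: cvg_cst.
    by apply: wave_cvg => //; exact: continuous_cos.
  by apply: wave_cvg => //; exact: continuous_sin.
- move=> k xi; have [ha hb] := density_bound abD xi.
  apply: (le_trans (ler_normB _ _)); rewrite (normrM (a xi)) (normrM (b xi)).
  by rewrite mulr_natl mulr2n; apply: lerD; apply: ler_pM => //; exact: normr_wave.
Qed.

(** Measurability is read off from Fubini's theorem applied with the weight itself as [w]; the
    positive weight is then divided out. *)
Lemma measurable_osum m (t N : R -> R) L : measurable_fun [set: R] t ->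
  measurable_fun [set: R] N -> (forall x, N x <= L) ->
  measurable_fun [set: R] (fun x => osum m (N x) (t x) x).
Proof.
move=> mt mN NL.
have W1 (x : R) : `|(oneDsqr x)^-1| <= (oneDsqr x)^-1 by rewrite ger0_norm// invr_ge0.
have [/int_meas h _] := integrable_osum ma mb iD D0 abD m mt mN measurable_oneDsqrV NL W1.
have -> : (fun x => osum m (N x) (t x) x) =
    (fun x => oneDsqr x * ((oneDsqr x)^-1 * osum m (N x) (t x) x)).
  by apply/funext => x; rewrite mulVKf// gt_eqF// (lt_le_trans _ (oneDsqr_ge1 x)).
apply: measurable_funM => //.
exact: (continuous_measurable_fun (@continuous_oneDsqr R)).
Qed.

Section Selection.
Context (m : R) (tt NN : nat -> R).

(* An index at which the maximum of the first [n + 1] terms is attained. *)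
Fixpoint sel (n : nat) (x : R) : nat :=
  if n is k.+1 then
    if `|osum m (NN (sel k x)) (tt (sel k x)) x| < `|osum m (NN k.+1) (tt k.+1) x|
    then k.+1 else sel k x
  else 0.

Lemma sel_le n x : (sel n x <= n)%N.
Proof. by elim: n => //= n IH; case: ifP => // _; exact: leqW. Qed.

Let NNle n : forall x, NN (sel n x) <= \sum_(j < n.+1) `|NN j|.
Proof.
move=> x; have h : (sel n x < n.+1)%N by rewrite ltnS sel_le.
rewrite (bigD1 (Ordinal h)) //= (le_trans (ler_norm _))// lerDl.
by apply: sumr_ge0.
Qed.

(** Quantified over [u] because the induction step uses it for the selected time and the selected
    truncation as well. *)
Lemma measurable_sel n (u : nat -> R) : measurable_fun [set: R] (fun x => u (sel n x)).
Proof.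
elim: n u => [|n IH] u /=; first exact: measurable_cst.
rewrite (_ : (fun _ => _) = fun x =>
  if `|osum m (NN (sel n x)) (tt (sel n x)) x| < `|osum m (NN n.+1) (tt n.+1) x|
  then u n.+1 else u (sel n x)); last by apply/funext => x; case: ifP.
apply: measurable_fun_ifT; [|exact: measurable_cst|exact: IH].
apply: measurable_fun_ltr; apply: measurableT_comp => //.
  exact: (measurable_osum m (IH tt) (IH NN) (NNle n)).
by apply: (measurable_osum m (L := NN n.+1)) => //; exact: measurable_cst.
Qed.

Definition smax n x := `|osum m (NN (sel n x)) (tt (sel n x)) x|.

Lemma smax_nd x : {homo smax^~ x : n k / (n <= k)%N >-> n <= k}.
Proof.
apply: homo_leq => [//|? ? ?|n]; first exact: le_trans.
by rewrite /smax /=; case: ifP => // /ltW.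
Qed.

Lemma smax_ge n x : `|osum m (NN n) (tt n) x| <= smax n x.
Proof.
by case: n => [|n] //; rewrite /smax /=; case: ltP.
Qed.

(** The sign of the selected value is moved into [w], which turns the linearized bound into a bound
    of the modulus. The right side depends neither on [n] nor on the sequences. *)
Lemma smax_bound n l : 1 <= m -> 0 < l ->
  mu.-integrable [set: R] (fun x => ((oneDsqr x)^-1 * smax n x)%:E) /\
  \int[mu]_x ((oneDsqr x)^-1 * smax n x) <=
    (2 * pi + l) * tail D m + l^-1 * tt_const.
Proof.
move=> m1 l0.
pose S x := osum m (NN (sel n x)) (tt (sel n x)) x.
have mS : measurable_fun [set: R] S.
  exact: (measurable_osum m (measurable_sel n tt) (measurable_sel n NN) (NNle n)).
pose w x := (if 0 <= S x then (oneDsqr x)^-1 else - (oneDsqr x)^-1).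
have mw : measurable_fun [set: R] w.
  apply: measurable_fun_ifT; [|exact: measurable_oneDsqrV|].
    by apply: measurable_fun_ler => //; exact: measurable_cst.
  by apply: measurableT_comp => //; exact: measurable_oneDsqrV.
have wW x : `|w x| <= (oneDsqr x)^-1.
  by rewrite /w; case: ifP => _; rewrite ?normrN ger0_norm// invr_ge0.
have E x : w x * S x = (oneDsqr x)^-1 * smax n x.
  rewrite /w /smax -/(S x); case: ifPn => h; first by rewrite ger0_norm.
  by rewrite ler0_norm ?mulNr ?mulrN// ltW// ltNge.
have [iS _] := integrable_osum ma mb iD D0 abD m (measurable_sel n tt)
  (measurable_sel n NN) mw (NNle n) wW.
have B := linearized_bound ma mb iD D0 abD m1 (measurable_sel n tt)
  (measurable_sel n NN) mw (NNle n) wW l0.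
split; first exact: (eq_int E iS).
rewrite -(eq_Rint E); apply: le_trans B; exact: ler_norm.
Qed.

End Selection.

End Density.
End MaximalSelection.

Section MaximalFunction.
Context {R : realType}.
Local Notation mu := (@lebesgue_measure R).

Section Density.
Context (a b D : R -> R).
Hypotheses (ma : measurable_fun [set: R] a) (mb : measurable_fun [set: R] b)
  (iD : mu.-integrable [set: R] (EFin \o D)) (D0 : forall xi, 0 <= D xi)
  (abD : forall xi, (`|a xi| <= D xi /\ `|b xi| <= D xi) \/
    (a xi ^+ 2 + b xi ^+ 2 <= D xi /\
     (a xi ^+ 2 + b xi ^+ 2) * Num.sqrt `|xi| <= D xi)).

Let osum := (@osum R a b).
Let W0 (x : R) : 0 <= (oneDsqr x)^-1. Proof. by rewrite invr_ge0. Qed.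

(** The maximum runs over an enumeration of rational pairs, and right continuity extends it to all
    real [t] and [N]. Monotone convergence preserves the bound, uniform in the number of pairs. One
    [S] serves for every [l], which remains free to be chosen later. *)
Lemma maximal_function m : 1 <= m -> exists S : R -> \bar R,
  [/\ measurable_fun [set: R] S, forall x, (0 <= S x)%E,
    forall t N x, (((oneDsqr x)^-1 * `|osum m N t x|)%:E <= S x)%E &
    forall l, 0 < l ->
      (\int[mu]_x S x <= ((2 * pi + l) * tail D m + l^-1 * tt_const)%:E)%E].
Proof.
move=> m1.
(* Indices that encode no pair yield [(0, 0)], which only repeats an element of the family. *)
pose pq n : rat * rat := odflt (0, 0) (unpickle n).
pose tt n : R := ratr (pq n).1; pose NN n : R := ratr (pq n).2.
pose g_ n x := ((oneDsqr x)^-1 * smax a b m tt NN n x)%:E.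
have sm0 n x : 0 <= smax a b m tt NN n x by exact: normr_ge0.
have g0 n x : (0 <= g_ n x)%E by rewrite lee_fin mulr_ge0.
have gnd x : {homo g_^~ x : n k / (n <= k)%N >-> (n <= k)%E}.
  by move=> n k nk; rewrite lee_fin ler_wpM2l// smax_nd.
have cg x : cvgn (g_^~ x) by exact: ereal_nondecreasing_is_cvgn.
have mg n : measurable_fun [set: R] (g_ n).
  exact: measurable_int (smax_bound ma mb iD D0 abD tt NN n m1 ltr01).1.
have gS n x : (g_ n x <= limn (g_^~ x))%E.
  by apply: lime_ge => //; near=> k; apply: gnd; near: k; exact: nbhs_infty_ge.
exists (fun x => limn (g_^~ x)); split.
- by apply: (@emeasurable_fun_cvg _ _ R _ g_ _ mg) => x _; exact: cg.
- by move=> x; exact: le_trans (g0 0%N x) (gS 0%N x).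
- move=> t N x.
  have /choice[tk tkt] : forall k, exists q : rat, t < ratr q < t + k.+1%:R^-1.
    move=> k.
    have [|q] := @rat_in_itvoo R t (t + k.+1%:R^-1); first by rewrite ltrDl invr_gt0.
    by rewrite in_itv /= => h; exists q.
  have /choice[Nk NkN] : forall k, exists q : rat, N < ratr q < N + k.+1%:R^-1.
    move=> k.
    have [|q] := @rat_in_itvoo R N (N + k.+1%:R^-1); first by rewrite ltrDl invr_gt0.
    by rewrite in_itv /= => h; exists q.
  have sq (u : R) (q : nat -> rat) : (forall k, u < ratr (q k) < u + k.+1%:R^-1) ->
      (ratr (q k) : R) @[k --> \oo] --> u.
    move=> h; apply: (@squeeze_cvgr _ _ _ _ (fun=> u) (fun k => u + k.+1%:R^-1)).
    - by apply: nearW => k; have /andP[/ltW -> /ltW ->] := h k.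
    - exact: cvg_cst.
    - rewrite -[X in _ --> X]addr0; apply: cvgD; first exact: cvg_cst.
      exact: cvg_harmonic.
  have c := @osum_right_continuous R a b D ma mb iD D0 abD m t N x _ _ (sq _ _ tkt) (sq _ _ NkN).
  have {}c : (((oneDsqr x)^-1 * `|osum m (ratr (Nk k)) (ratr (tk k)) x|)%:E)
      @[k --> \oo] --> ((oneDsqr x)^-1 * `|osum m N t x|)%:E.
    apply: cvg_EFin; first exact: nearW.
    apply: cvgM; first exact: cvg_cst.
    apply: cvg_norm; apply: c => k; have /andP[/ltW -> h] := NkN k.
    rewrite ltW//= (lt_le_trans h)// lerD2l invf_le1 ?ler1n//.
  rewrite -(cvg_lim _ c)//; apply: lime_le; first by apply/cvg_ex; eexists; exact: c.
  apply: nearW => k.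
  pose j := pickle (tk k, Nk k).
  apply: le_trans (gS j x); rewrite lee_fin ler_wpM2l//.
  have := smax_ge a b m tt NN j x.
  by rewrite /tt /NN /pq pickleK.
- move=> l l0.
  rewrite (monotone_convergence mu measurableT mg (fun n x _ => g0 n x) (fun x _ => gnd x)).
  apply: lime_le.
    apply: ereal_nondecreasing_is_cvgn => n k nk; apply: ge0_le_integral;
      [exact: measurableT|by move=> x _; exact: g0|exact: mg|exact: mg|by move=> x _; exact: gnd].
  apply: nearW => n.
  have [ig gb] := smax_bound ma mb iD D0 abD tt NN n m1 l0.
  rewrite -lee_fin in gb; apply: le_trans gb.
  by rewrite /Rintegral fineK//; exact: integrable_fin_num ig.
Unshelve. all: by end_near. Qed.

Lemma tail_cvg : tail D n.+1%:R @[n --> \oo] --> 0.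
Proof.
have mD : measurable_fun [set: R] D by exact: int_meas.
pose f_ n xi := if n.+1%:R < `|xi| then D xi else 0.
have [|||_ h] := @Rint_cvg R f_ (fun=> 0) D _ _ iD.
- by move=> n; exact: int_meas (integrable_tail iD n.+1%:R).
- move=> xi; apply: cvg_near_cst.
  have : \forall n \near \oo, `|xi| <= n%:R by exact: nbhs_infty_ger.
  apply: filterS => n xn; rewrite /f_ ifF//; apply/negbTE; rewrite -leNgt.
  by rewrite (le_trans xn)// ler_nat.
- by move=> n xi; rewrite /f_; case: ifP => _; rewrite ?normr0// ger0_norm.
by rewrite Rintegral_cst// mul0r in h.
Qed.

Lemma maximal_functions : exists S : nat -> R -> \bar R,
  [/\ forall n, measurable_fun [set: R] (S n), forall n x, (0 <= S n x)%E,
    forall n t N x, (((oneDsqr x)^-1 * `|osum n.+1%:R N t x|)%:E <= S n x)%E &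
    forall e, 0 < e -> \forall n \near \oo, (\int[mu]_x S n x <= e%:E)%E].
Proof.
have /choice[S hS] : forall n, exists S : R -> \bar R,
  [/\ measurable_fun [set: R] S, forall x, (0 <= S x)%E,
    forall t N x, (((oneDsqr x)^-1 * `|osum n.+1%:R N t x|)%:E <= S x)%E &
    forall l, 0 < l -> (\int[mu]_x S x <=
      ((2 * pi + l) * tail D n.+1%:R + l^-1 * tt_const)%:E)%E].
  by move=> n; apply: maximal_function; rewrite ler1n.
exists S; split; try by move=> n; case: (hS n).
move=> e e0.
have tt0 : 0 <= tt_const :> R.
  apply: mulr_ge0; last exact: pi_ge0.
  apply: mulr_ge0; last by rewrite addr_ge0// pi_ge0.
  by apply: mulr_ge0 => //; exact: osc_const_ge0.
(* Fixed before [n]: it brings the second term below [e / 2], after which the tail has to absorb the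
   fixed factor [2 pi + l]. The summand 1 guarantees [0 < l]. *)
pose l : R := 2 * tt_const / e + 1.
have l0 : 0 < l by rewrite ltr_wpDl// divr_ge0 ?(ltW e0)// mulr_ge0.
have le : l^-1 * tt_const <= e / 2.
  rewrite mulrC ler_pdivrMr// /l mulrDr mulr1.
  have -> : e / 2 * (2 * tt_const / e) = tt_const by field; rewrite gt_eqF.
  by rewrite lerDl divr_ge0// ltW.
have pl : 0 < 2 * pi + l by rewrite ltr_wpDl// mulr_ge0// pi_ge0.
have e2 : 0 < e / 2 / (2 * pi + l) by rewrite !divr_gt0.
have := tail_cvg => /cvgr0_norm_le /(_ _ e2); apply: filterS => n tn.
have [_ _ _ /(_ l l0) h] := hS n; apply: (le_trans h); rewrite lee_fin.
rewrite (_ : e = e / 2 + e / 2); last by field.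
apply: lerD => //.
by rewrite -(ler_pdivlMl _ _ pl) mulrC (le_trans (ler_norm _)).
Qed.

(** The infimum over [n] of the functions [S n] has integral 0, hence vanishes almost everywhere;
    where it does, some [S n x] lies below the weight times [e]. No subsequence is extracted. *)
Lemma ae_uniform_tail : {ae mu, forall x, forall e, 0 < e ->
  exists n : nat, forall t N, `|osum n.+1%:R N t x| <= e}.
Proof.
have [S [mS S0 SX Se]] := maximal_functions.
pose inS x := einfs (S^~ x) 0.
have mI : measurable_fun [set: R] inS by exact: measurable_fun_einfs.
have IS n x : (inS x <= S n x)%E.
  by apply: ereal_inf_lbound; exists n.
have I0 x : (0 <= inS x)%E by apply: le_ereal_inf_tmp => _ [n _ <-]; exact: S0.
have iI : (\int[mu]_x `|inS x| = 0)%E.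
  apply/eqP; rewrite eq_le integral_ge0 ?andbT; last by move=> x _; exact: abse_ge0.
  apply/lee_addgt0Pr => e e0; rewrite add0e.
  have [n _ /(_ n (leqnn n)) h] := Se e e0.
  apply: le_trans h; apply: ge0_le_integral;
    [exact: measurableT|by []|exact: measurableT_comp|exact: mS|].
  by move=> x _; rewrite gee0_abs.
have := (ae_eq_integral_abs mu measurableT mI).1 iI; apply: filterS => x /(_ I) Ix0 e e0.
have We : (0 < ((oneDsqr x)^-1 * e)%:E)%E.
  by rewrite lte_fin mulr_gt0// invr_gt0 (lt_le_trans _ (oneDsqr_ge1 x)).
have : (inS x < ((oneDsqr x)^-1 * e)%:E)%E by rewrite Ix0.
move=> /ereal_inf_lt[_ [n _ <-]] Sn; exists n => t N.
have := le_lt_trans (SX n t N x) Sn.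
by rewrite lte_fin ltr_pM2l ?invr_gt0 ?(lt_le_trans _ (oneDsqr_ge1 x))// => /ltW.
Qed.

End Density.
End MaximalFunction.

(** * Almost everywhere and weighted L1 convergence *)

Section UniformLimit.
Context {R : realType}.
Implicit Types Y : R -> R -> R.

(** The Moore-Osgood exchange of limits: [N0] depends on [e] but not on [t], so the limit in [N] is
    uniform in [t] and inherits continuity at 0. *)
Lemma uniform_limit Y :
  (forall e, 0 < e -> exists N0 : R, forall t N, N0 <= N -> `|Y N t - Y N0 t| <= e) ->
  (forall N, Y N t @[t --> (0 : R)^'] --> Y N 0) ->
  exists l : R -> R, (forall t, Y N t @[N --> +oo] --> l t) /\
    l t @[t --> (0 : R)^'] --> l 0.
Proof.
move=> Yu Yc.
have cY t : cvg (Y N t @[N --> +oo]).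
  apply/cauchy_cvgP/cauchy_exP => e e0.
  have e2 : 0 < e / 2 by rewrite divr_gt0.
  have [N0 h] := Yu (e / 2) e2.
  exists (Y N0 t).
  suff : \forall N \near +oo, ball (Y N0 t) e (Y N t) by [].
  near=> N; rewrite /ball /= distrC; apply: (@le_lt_trans _ _ (e / 2)).
    by apply: h; near: N; apply: nbhs_pinfty_ge; exact: num_real.
  by rewrite ltr_pdivrMr// ltr_pMr// ltr1n.
exists (fun t => lim (Y N t @[N --> +oo])); split; first exact: cY.
have lY e N0 : (forall t N, N0 <= N -> `|Y N t - Y N0 t| <= e) ->
   forall t, `|lim (Y N t @[N --> +oo]) - Y N0 t| <= e.
  move=> h t.
  have c : `|Y N t - Y N0 t| @[N --> +oo] --> `|lim (Y N t @[N --> +oo]) - Y N0 t|.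
    by apply: cvg_norm; apply: cvgB; [exact: cY|exact: cvg_cst].
  rewrite -(cvg_lim _ c)//; apply: limr_le; first by apply/cvg_ex; eexists; exact: c.
  by near=> N; apply: h; near: N; apply: nbhs_pinfty_ge; exact: num_real.
apply/cvgrPdist_le => e e0.
have e3 : 0 < e / 3 by rewrite divr_gt0.
have [N0 /lY h] := Yu (e / 3) e3.
have := Yc N0 => /cvgrPdist_le/(_ _ e3); apply: filterS => t Yt.
have := h t; have := h 0; move: Yt; rewrite !ler_norml => /andP[? ?] /andP[? ?] /andP[? ?].
by apply/andP; split; lra.
Unshelve. all: by end_near. Qed.

End UniformLimit.

Section AEConvergence.
Context {R : realType}.
Local Notation mu := (@lebesgue_measure R).
Context (a b D : R -> R).
Hypotheses (ma : measurable_fun [set: R] a) (mb : measurable_fun [set: R] b)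
  (iD : mu.-integrable [set: R] (EFin \o D)) (D0 : forall xi, 0 <= D xi)
  (abD : forall xi, (`|a xi| <= D xi /\ `|b xi| <= D xi) \/
    (a xi ^+ 2 + b xi ^+ 2 <= D xi /\
     (a xi ^+ 2 + b xi ^+ 2) * Num.sqrt `|xi| <= D xi)).

(* Since [-1 < |xi|] always holds, [osum a b (-1) N t x] is the integral over
   the whole of [-N, N]. *)
Let X := osum a b (-1).

Lemma osum_split N0 N t x : N0 <= N -> X N t x - X N0 t x = osum a b N0 N t x.
Proof.
move=> NN.
have E xi : band (-1) N xi - band (-1) N0 xi = band N0 N xi.
  have x0 : -1 < `|xi| by rewrite (lt_le_trans _ (normr_ge0 _)).
  rewrite /band x0 /=; have [h1|h1] := leP `|xi| N0; have [h2|h2] := leP `|xi| N => //=.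
  - by rewrite subrr.
  - by have := lt_le_trans h2 (le_trans h1 NN); rewrite ltxx.
  - by rewrite subr0.
  - by rewrite subrr.
have j N1 : mu.-integrable [set: R] (EFin \o (fun xi =>
    a xi * wave cos (-1) N1 t x xi - b xi * wave sin (-1) N1 t x xi)).
  apply: intB.
    exact: (integrable_wave iD D0 _ _ _ _ (@measurable_cos R) (@cos_bound R) ma
      (fun xi => (density_bound abD xi).1)).
  exact: (integrable_wave iD D0 _ _ _ _ (@measurable_sin R) (@sin_bound R) mb
    (fun xi => (density_bound abD xi).2)).
rewrite /X /osum -(RintB (j N) (j N0)); apply: eq_Rint => xi.
by rewrite /wave -E; ring.
Qed.

Lemma osum_cvg_t N x : X N t x @[t --> (0 : R)^'] --> X N 0 x.
Proof.
apply/cvgr_dnbhsP => u [_ u0].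
apply: (osum_right_continuous ma mb iD D0 abD u0 (cvg_cst N)) => k.
by rewrite lexx /= lerDl.
Qed.

Lemma ae_convergence : {ae mu, forall x, exists l : R -> R,
  (forall t, X N t x @[N --> +oo] --> l t) /\ l t @[t --> (0 : R)^'] --> l 0}.
Proof.
have := ae_uniform_tail ma mb iD D0 abD; apply: (@filterS _ _ (ae_filter_ringOfSetsType _)) => x ux.
apply: (@uniform_limit R (fun N t => X N t x)); last by move=> N; exact: osum_cvg_t.
move=> e e0; have [n h] := ux e e0; exists n.+1%:R => t N nN.
by rewrite osum_split.
Qed.

(** Pointwise convergence alone would not identify [F] with a distribution; the maximal functions
    also dominate the errors, which yields weighted L1 convergence, and one integrable error is
    enough for the integrability of the weighted [F]. *)
Lemma L1_limit : exists F : R -> R,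
  [/\ measurable_fun [set: R] F,
   {ae mu, forall x, exists l : R -> R, [/\ l 0 = F x,
     (forall t, X N t x @[N --> +oo] --> l t) & l t @[t --> (0 : R)^'] --> l 0]},
   mu.-integrable [set: R] (fun x => ((oneDsqr x)^-1 * F x)%:E) &
   \int[mu]_x ((oneDsqr x)^-1 * `|F x - X n.+1%:R 0 x|) @[n --> \oo] --> 0 ].
Proof.
have [S [mS S0 SX Se]] := maximal_functions ma mb iD D0 abD.
(* An upper limit is measurable without knowing where the sequence converges; at almost every [x] it
   is the limit [l 0]. *)
pose F x := fine (limn_esup (fun n => (X n.+1%:R 0 x)%:E)).
have mX N : measurable_fun [set: R] (X N 0).
  by apply: (@measurable_osum R a b D ma mb iD D0 abD (-1) (cst 0) (cst N) N) => //; exact: measurable_cst.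
have mF : measurable_fun [set: R] F.
  apply: measurableT_comp => //; apply: measurable_fun_limn_esup => n.
  by apply/measurable_EFinP; exact: mX.
have aeF : {ae mu, forall x, exists l : R -> R, [/\ l 0 = F x,
     (forall t, X N t x @[N --> +oo] --> l t) & l t @[t --> (0 : R)^'] --> l 0]}.
  have := ae_convergence.
  apply: (@filterS _ _ (ae_filter_ringOfSetsType _)) => x [l [cl l0]]; exists l; split => //.
  have c : (X n.+1%:R 0 x)%:E @[n --> \oo] --> (l 0)%:E.
    apply: cvg_EFin; first exact: nearW.
    apply: (cvg_comp (fun n => n.+1%:R) (fun N => X N 0 x)); last exact: cl.
    by rewrite (cvg_shiftS (fun n => n%:R : R)); exact: cvgr_idn.
  by rewrite /F is_cvg_limn_esupE; [rewrite (cvg_lim _ c)|apply/cvg_ex; eexists; exact: c].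
have W0 (x : R) : 0 <= (oneDsqr x)^-1 by rewrite invr_ge0.
have W1 (x : R) : `|(oneDsqr x)^-1| <= (oneDsqr x)^-1 by rewrite ger0_norm.
have iX n : mu.-integrable [set: R] (EFin \o (fun x => (oneDsqr x)^-1 * X n.+1%:R 0 x)).
  by apply: (@integrable_osum R a b D ma mb iD D0 abD (-1) n.+1%:R (cst 0) (cst n.+1%:R)
    (fun x => (oneDsqr x)^-1) _ _ measurable_oneDsqrV _ W1).1 => //; exact: measurable_cst.
pose d n x := (oneDsqr x)^-1 * `|F x - X n.+1%:R 0 x|.
have d0 n x : 0 <= d n x by rewrite mulr_ge0.
have md n : measurable_fun [set: R] (d n).
  apply: measurable_funM; first exact: measurable_oneDsqrV.
  by apply: measurableT_comp => //; apply: measurable_funB.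
(* [S n] dominates the weighted tails for all [N] at once, so the bound survives the limit
   [N -> +oo]. *)
have dS n : (\int[mu]_x (d n x)%:E <= \int[mu]_x S n x)%E.
  apply: ae_ge0_le_integral.
  - exact: measurableT.
  - by move=> x _; rewrite lee_fin.
  - by apply/measurable_EFinP; exact: md.
  - by move=> x _.
  - exact: mS.
  have := aeF; apply: (@filterS _ _ (ae_filter_ringOfSetsType _)) => x [l [lF cl _]] _; rewrite /d -lF.
  have c : (((oneDsqr x)^-1 * `|X N 0 x - X n.+1%:R 0 x|)%:E) @[N --> +oo] -->
      ((oneDsqr x)^-1 * `|l 0 - X n.+1%:R 0 x|)%:E.
    apply: cvg_EFin; first exact: nearW.
    apply: cvgM; first exact: cvg_cst.
    by apply: cvg_norm; apply: cvgB; [exact: cl|exact: cvg_cst].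
  rewrite -(cvg_lim _ c)//; apply: lime_le; first by apply/cvg_ex; eexists; exact: c.
  near=> N; rewrite osum_split; first exact: SX.
  by near: N; apply: nbhs_pinfty_ge; exact: num_real.
have dfin e : 0 < e -> \forall n \near \oo,
    mu.-integrable [set: R] (EFin \o d n) /\ \int[mu]_x d n x <= e.
  move=> /Se; apply: filterS => n Sn.
  have de : (\int[mu]_x (d n x)%:E <= e%:E)%E by exact: le_trans (dS n) Sn.
  have id : mu.-integrable [set: R] (EFin \o d n).
    apply/integrableP; split; first by apply/measurable_EFinP; exact: md.
    under eq_integral do rewrite gee0_abs ?lee_fin//.
    by rewrite (le_lt_trans de)// ltry.
  split => //; rewrite -lee_fin; apply: le_trans de.
  by rewrite /Rintegral fineK//; exact: integrable_fin_num id.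
exists F; split => //.
- have [n _ /(_ n (leqnn n)) [idn _]] := dfin 1 ltr01.
  have mWF : measurable_fun [set: R] (fun x => (oneDsqr x)^-1 * F x).
    by apply: measurable_funM => //; exact: measurable_oneDsqrV.
  apply: (le_int mWF _ (intD idn (integrable_norm (iX n)))) => x.
  rewrite /= [leRHS]ger0_norm ?addr_ge0// (normrM _ (F x)) (ger0_norm (W0 x))
    /d (normrM _ (X _ _ _)) (ger0_norm (W0 x)).
  by rewrite -mulrDr ler_wpM2l// -[X in `|X| <= _](subrK (X n.+1%:R 0 x)) ler_normD.
- apply/cvgr0Pnorm_le => e e0; have := dfin e e0; apply: filterS => n [_ h].
  by rewrite ger0_norm// Rintegral_ge0.
Unshelve. all: by end_near. Qed.

End AEConvergence.

(** * Schwartz functions and Fourier inversion *)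

Section RSchwartz.
Context {R : realType}.
Local Notation mu := (@lebesgue_measure R).
Implicit Types (u v h : R -> R) (x xi : R) (n k : nat).

Definition rschwartz u := smooth u /\
  forall k n, exists M : R, forall x, `|x| ^+ k * `|derive1n n u x| <= M.

Lemma smooth_derive u n x : smooth u -> is_derive x 1 (derive1n n u) (derive1n n.+1 u x).
Proof. by move=> su; apply: DeriveDef; [exact: su|rewrite derive1nS derive1E]. Qed.

Lemma derive1_funE h (dh : R -> R) : (forall x, is_derive x 1 h (dh x)) -> derive1 h = dh.
Proof. by move=> dhP; apply/funext => x; rewrite derive1E; case: (dhP x). Qed.

Lemma smooth_derive0 u x : smooth u -> is_derive x 1 u (derive1 u x).
Proof. by move=> su; rewrite -derive1n1; exact: (smooth_derive 0 x su). Qed.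

Lemma rs_smooth_deriv u : rschwartz u -> rschwartz (derive1 u).
Proof.
move=> [su du]; split=> [n x|k n]; first by rewrite -derive1Sn; exact: su.
by have [M h] := du k n.+1; exists M => x; rewrite -derive1Sn.
Qed.

Lemma derive1n_lin (c : R) u v n : smooth u -> smooth v ->
  derive1n n (fun x => c * u x + v x) = fun x => c * derive1n n u x + derive1n n v x.
Proof.
move=> su sv; elim: n => [//|n IH]; rewrite derive1nS IH; apply: derive1_funE => x.
exact: (derD (derZ c (smooth_derive n x su)) (smooth_derive n x sv)).
Qed.

Lemma rs_lin (c : R) u v : rschwartz u -> rschwartz v ->
  rschwartz (fun x => c * u x + v x).
Proof.
move=> [su du] [sv dv]; split=> [n x|k n]; rewrite (derive1n_lin _ _ su sv).
  by case: (derD (derZ c (smooth_derive n x su)) (smooth_derive n x sv)).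
have [M h] := du k n; have [M' h'] := dv k n; exists (`|c| * M + M') => x.
rewrite (le_trans (ler_wpM2l _ (ler_normD _ _))) ?exprn_ge0//.
by rewrite mulrDr normrM mulrCA lerD// ler_wpM2l.
Qed.

Lemma derive1n_mulx u n : smooth u -> derive1n n (fun x => x * u x) =
  fun x => x * derive1n n u x + n%:R * derive1n n.-1 u x.
Proof.
move=> su; elim: n => [|n IH].
  by apply/funext => x; rewrite /= mul0r addr0.
rewrite derive1nS IH; apply: derive1_funE => x.
have d1 : is_derive x 1 (fun x => x * derive1n n u x) (x * derive1n n.+1 u x + derive1n n u x * 1).
  by notypeclasses refine (derM (derI _) _); exact: smooth_derive.
have d2 : is_derive x 1 (fun x => n%:R * derive1n n.-1 u x) (n%:R * derive1n n u x).
  case: n {IH d1} => [|n] /=.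
    under eq_fun do rewrite mul0r; rewrite mul0r; exact: derC.
  exact: (derZ n.+1%:R (smooth_derive n x su)).
apply: is_derive_eq (derD d1 d2) _ => /=.
by rewrite mulr1 -addrA -{1}[derive1n n u x]mul1r -mulrDl -natr1 (addrC 1).
Qed.

Lemma rs_mulx u : rschwartz u -> rschwartz (fun x => x * u x).
Proof.
move=> [su du]; split=> [n x|k n]; rewrite derive1n_mulx//.
  by case: (derD (derM (derI x) (smooth_derive n x su)) (derZ n%:R (smooth_derive n.-1 x su))).
have [M h] := du k.+1 n; have [M' h'] := du k n.-1; exists (M + n%:R * M') => x.
rewrite (le_trans (ler_wpM2l _ (ler_normD _ _))) ?exprn_ge0//.
rewrite mulrDr normrM mulrA -exprSr lerD// normrM mulrCA ger0_norm//.
by rewrite ler_wpM2l.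
Qed.

(** Meant for the class of all cosine and sine transforms of Schwartz functions, for which it avoids
    any formula for higher derivatives. *)
Lemma rs_class (P : (R -> R) -> Prop) :
  (forall h, P h -> [/\ forall x, derivable h x 1, P (derive1 h),
     P (fun x => x * h x) & exists M : R, forall x, `|h x| <= M]) ->
  forall h, P h -> rschwartz h.
Proof.
move=> Pc h Ph.
have Pn n : P (derive1n n h).
  by elim: n => // n IH; rewrite derive1nS; case: (Pc _ IH).
split=> [n x|k n]; first by case: (Pc _ (Pn n)).
have : P (fun x => x ^+ k * derive1n n h x).
  elim: k => [|k IH]; first by under eq_fun do rewrite mul1r; exact: Pn.
  by under eq_fun do rewrite exprS -mulrA; case: (Pc _ IH).
move=> /Pc[_ _ _ [M hM]]; exists M => x.
by rewrite -normrX -normrM.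
Qed.

Lemma rs_cont u : rschwartz u -> continuous u.
Proof. by move=> [su _] x; exact: der_cont (smooth_derive0 x su). Qed.

Lemma rs_bounded u : rschwartz u -> exists M : R, forall x, `|u x| <= M.
Proof. by move=> [_ /(_ 0%N 0%N)[M h]]; exists M => x; have := h x; rewrite mul1r. Qed.

(** The link with the maximal estimates: a multiple of a Schwartz function is an admissible [w]. *)
Lemma rs_weight u : rschwartz u -> exists2 M : R, 0 <= M & forall x, `|u x| <= M * (oneDsqr x)^-1.
Proof.
move=> [_ du]; have [M h] := du 0%N 0%N; have [M' h'] := du 2%N 0%N.
have M0 : 0 <= M + M'.
  by apply: addr_ge0; [apply: le_trans (h 0)|apply: le_trans (h' 0)]; rewrite mulr_ge0 ?exprn_ge0.
exists (M + M') => // x.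
rewrite ler_pdivlMr ?(lt_le_trans _ (oneDsqr_ge1 x))// /oneDsqr.
have := h x; have := h' x; rewrite /= mul1r real_normK ?num_real// => h1 h2.
by rewrite mulrDr mulr1 mulrC lerD// .
Qed.

Lemma rs_meas u : rschwartz u -> measurable_fun [set: R] u.
Proof. by move=> ru; exact: (continuous_measurable_fun (rs_cont ru)). Qed.

Lemma rs_int u : rschwartz u -> mu.-integrable [set: R] (EFin \o u).
Proof.
move=> ru; have [M M0 uM] := rs_weight ru.
apply: (le_int (rs_meas ru) _ (intZ M integrable_oneDsqrV.1)) => x.
by rewrite (le_trans (uM x))// ler_norm.
Qed.

End RSchwartz.

(** * Cosine and sine transforms of Schwartz functions *)

Section Transforms.
Context {R : realType}.
Local Notation mu := (@lebesgue_measure R).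
Local Notation I f := (mu.-integrable [set: R] (EFin \o f)).
Implicit Types (u v h : R -> R) (x y xi : R) (n k : nat).

Definition trig (T : R -> R) u xi := \int[mu]_x (T (x * xi) * u x).

Lemma int_bounded (T u : R -> R) : measurable_fun [set: R] T -> (forall x, `|T x| <= 1) ->
  I u -> I (fun x => T x * u x).
Proof.
move=> mT T1 ju; apply: (le_int _ _ ju) => [|x].
  by apply: measurable_funM => //; exact: int_meas.
by rewrite normrM ler_piMl.
Qed.

Lemma Rint_expand u : I u ->
  \int[mu]_(x in `[- n%:R, n%:R]) u x @[n --> \oo] --> \int[mu]_x u x.
Proof.
move=> ju.
under eq_fun do rewrite Rintegral_mkcond.
have mu_ := int_meas ju.
have [||||_ h] := @Rint_cvg R (fun n => u \_ `[- n%:R, n%:R]) u (fun x => `|u x|).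
- by move=> n; apply/(measurable_restrictT _ _).1 => //; exact: measurable_funTS.
- move=> x; apply: cvg_near_cst.
  have : \forall n \near \oo, `|x| <= n%:R by exact: nbhs_infty_ger.
  by apply: filterS => n; rewrite ler_norml => h; rewrite patchE mem_set//= in_itv.
- exact: integrable_norm.
- by move=> n x; rewrite patchE; case: ifP => // _; rewrite normr0.
exact: h.
Qed.

Lemma Rint_sym u : continuous u -> I u ->
  \int[mu]_(x in `[0, n%:R]) (u x + u (- x)) @[n --> \oo] --> \int[mu]_x u x.
Proof.
move=> cu ju; apply: cvg_trans (Rint_expand ju).
apply: near_eq_cvg; apply: nearW => n.
have n0 : 0 <= n%:R :> R by [].
have cN : continuous (fun x => u (- x)).
  by move=> x; apply: (cvg_comp (fun x => - x) u); [exact: opp_continuous|exact: cu].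
have i0 (h : R -> R) (p q : R) : continuous h -> mu.-integrable `[p, q] (EFin \o h).
  move=> ch; apply: continuous_compact_integrable; first exact: segment_compact.
  exact: continuous_subspaceT.
rewrite RintegralD//; [|exact: i0|exact: i0].
have := @Rintegral_itvB R u (BLeft (- n%:R)) (BRight n%:R) 0 (i0 _ _ _ cu).
rewrite !bnd_simp oppr_le0 => /(_ n0 n0).
rewrite Rintegral_itv_obnd_cbnd//; last first.
  by apply: integrableS (i0 u 0 n%:R cu) => //; apply: subset_itvr; rewrite bnd_simp.
move/eqP; rewrite subr_eq => /eqP ->; congr (_ + _).
rewrite /Rintegral -{1}oppr0 integration_by_substitution_oppr//.
exact: continuous_subspaceT.
Qed.

Lemma Rint_odd u : continuous u -> I u -> (forall x, u (- x) = - u x) ->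
  \int[mu]_x u x = 0.
Proof.
move=> cu ju ou; rewrite -(cvg_lim _ (Rint_sym cu ju))//.
under eq_fun do under eq_Rintegral do rewrite ou subrr.
by under eq_fun do rewrite Rintegral_cst// mul0r; rewrite lim_cst.
Qed.

Lemma oneDsqrV_cvg0 (M : R) : M * (oneDsqr n%:R)^-1 @[n --> \oo] --> 0.
Proof.
rewrite -[X in _ --> X](mulr0 M); apply: cvgM; first exact: cvg_cst.
apply/cvgr0Pnorm_le => e e0.
have : \forall n \near \oo, e^-1 <= n%:R by exact: nbhs_infty_ger.
apply: filterS => n en; rewrite ger0_norm ?invr_ge0//.
rewrite -(invrK e) lef_pV2 ?posrE ?invr_gt0// ?(lt_le_trans _ (oneDsqr_ge1 _))//.
by rewrite (le_trans en)// /oneDsqr; have := sqr_ge0 (n%:R - 1 : R); nra.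
Qed.

Lemma Rint_deriv0 (G g : R -> R) (M : R) : (forall x, is_derive x 1 G (g x)) ->
  continuous g -> I g -> (forall x, `|G x| <= M * (oneDsqr x)^-1) ->
  \int[mu]_x g x = 0.
Proof.
move=> dG cg jg GM; rewrite -(cvg_lim _ (Rint_expand jg))//; apply: cvg_lim => //.
apply/cvgr0Pnorm_le => e e0.
have /cvgr0_norm_le/(_ e e0) := @oneDsqrV_cvg0 (2 * M).
apply: filterS => n h.
have n0 : - n%:R <= n%:R :> R by rewrite (@le_trans _ _ 0)// oppr_le0.
have [_ ->] := ftc n0 (fun x _ => dG x) (fun x _ => cg x).
rewrite (le_trans (ler_normB _ _))// (le_trans _ h)// (le_trans _ (ler_norm _))//.
have := GM n%:R; have := GM (- n%:R); rewrite /oneDsqr sqrrN; lra.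
Qed.

Section Diff.
Context (T T' : R -> R) (dT : forall x, is_derive x 1 T (T' x)) (cT' : continuous T')
  (T1 : forall x, `|T x| <= 1) (T'1 : forall x, `|T' x| <= 1).

Let cT : continuous T. Proof. by move=> x; exact: der_cont (dT x). Qed.

Let cTm (S : R -> R) xi : continuous S -> continuous (fun x => S (x * xi)).
Proof.
by move=> cS x; apply: (cvg_comp (fun x => x * xi) S); [exact: mulrr_continuous|exact: cS].
Qed.

Lemma trig_int (S : R -> R) u xi : continuous S -> (forall x, `|S x| <= 1) -> I u ->
  I (fun x => S (x * xi) * u x).
Proof.
by move=> cS S1 ju; apply: int_bounded => //; exact: (continuous_measurable_fun (cTm cS)).
Qed.

Lemma trig_bound (S : R -> R) u xi : continuous S -> (forall x, `|S x| <= 1) -> I u ->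
  `|trig S u xi| <= \int[mu]_x `|u x|.
Proof.
move=> cS S1 ju; apply: (normr_Rint (trig_int xi cS S1 ju) (integrable_norm ju)) => x.
by rewrite normrM ler_piMl.
Qed.

Lemma trig_deriv u xi : rschwartz u ->
  is_derive xi 1 (trig T u) (trig T' (fun x => x * u x) xi).
Proof.
move=> ru.
pose f (z x : R) := T (x * z) * u x.
have ju := rs_int ru; have jxu := rs_int (rs_mulx ru).
have df (z x : R) : is_derive z 1 (f ^~ x) (T' (x * z) * (x * u x)).
  apply: is_derive_eq (derM (derF (F := T) (dT (x * z)) (derZ x (derI z))) (derC (u x) z)) _.
  by rewrite mulr0 add0r mulr1 mulrC -mulrA.
have jf z : `]xi - 1, xi + 1[%classic z -> I (f z) by move=> _; exact: trig_int.
have Ixi : `]xi - 1, xi + 1[%classic xi.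
  by rewrite /= in_itv /= ltrBlDr ltrDl ltr01.
have derf z x : `]xi - 1, xi + 1[%classic z -> [set: R] x -> derivable (f ^~ x) z 1.
  by move=> _ _; case: (df z x).
have fE z x : partial1of2 f z x = T' (x * z) * (x * u x).
  by rewrite partial1of2E; case: (df z x).
have Gb z x : `]xi - 1, xi + 1[%classic z -> [set: R] x -> `|partial1of2 f z x| <= `|x * u x|.
  by move=> _ _; rewrite fE normrM ler_piMl.
have jG := integrable_norm jxu.
have G0 x : 0 <= `|x * u x| by [].
apply: DeriveDef.
  exact: (derivable_under_integral measurableT Ixi jf derf G0 jG Gb).
rewrite -derive1E (differentiation_under_integral measurableT Ixi jf derf G0 jG Gb).
by apply: eq_Rint => x; rewrite fE.
Qed.

(** Integration by parts: the derivative in [x] of [T (x xi) u x] integrates to 0. *)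
Lemma trig_mul u xi : rschwartz u ->
  xi * trig T' u xi = - trig T (derive1 u) xi.
Proof.
move=> ru; have ru' := rs_smooth_deriv ru.
have [M M0 uM] := rs_weight ru.
have cT'm := cTm (xi := xi) cT'; have cTm_ := cTm (xi := xi) cT.
have dG x : is_derive x 1 (fun x => T (x * xi) * u x)
    (T (x * xi) * derive1 u x + u x * (T' (x * xi) * (x * 0 + xi * 1))).
  have d1 : is_derive x 1 (fun x : R => x * xi) (x * 0 + xi * 1) := derM (derI x) (derC xi x).
  have d2 : is_derive x 1 (fun x => T (x * xi)) (T' (x * xi) * (x * 0 + xi * 1)).
    exact: (derF (F := T) (f := fun x => x * xi) (dT (x * xi)) d1).
  exact: (derM d2 (smooth_derive0 x ru.1)).
have E x : T (x * xi) * derive1 u x + u x * (T' (x * xi) * (x * 0 + xi * 1)) =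
  xi * (T' (x * xi) * u x) + T (x * xi) * derive1 u x by ring.
have j1 := intZ xi (trig_int xi cT' T'1 (rs_int ru)).
have j2 := trig_int xi cT T1 (rs_int ru').
have := @Rint_deriv0 _ _ M (fun x => is_derive_eq (dG x) (E x)) _ (intD j1 j2).
rewrite (RintD j1 j2) (RintZ xi (trig_int xi cT' T'1 (rs_int ru))).
move=> h; apply/eqP; rewrite -addr_eq0; apply/eqP; apply: h => [x|x].
  apply: cvgD; last by apply: cvgM; [exact: cTm_|exact: rs_cont].
  by apply: cvgM; [exact: cvg_cst|apply: cvgM; [exact: cT'm|exact: rs_cont]].
by rewrite normrM (le_trans _ (uM x))// ler_piMl.
Qed.

End Diff.

Let dcos (x : R) : is_derive x 1 (@cos R) ((fun y => - sin y) x) := is_derive_cos x.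
Let dsin (x : R) : is_derive x 1 (@sin R) (cos x) := is_derive_sin x.
Let Nsin_bound x : `|- sin x : R| <= 1. Proof. by rewrite normrN sin_bound. Qed.
Let cNsin : continuous (fun x : R => - sin x).
Proof. by move=> x; apply: cvgN; exact: continuous_sin. Qed.

Lemma trig_Nsin u xi : rschwartz u -> trig (fun y => - sin y) u xi = - trig sin u xi.
Proof.
move=> ru; rewrite /trig -[RHS]mulN1r -RintZ.
  by apply: eq_Rint => x; rewrite mulN1r mulNr.
exact: trig_int (@continuous_sin R) sin_bound (rs_int ru).
Qed.

Lemma trigN (T : R -> R) u xi : continuous T -> (forall x, `|T x| <= 1) -> rschwartz u ->
  trig T (fun x => - u x) xi = - trig T u xi.
Proof.
move=> cT T1 ru; rewrite /trig -[RHS]mulN1r -RintZ.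
  by apply: eq_Rint => x; rewrite mulN1r mulrN.
exact: trig_int cT T1 (rs_int ru).
Qed.

Lemma rsN u : rschwartz u -> rschwartz (fun x => - u x).
Proof.
by move=> ru; have := rs_lin (-2) ru ru; congr rschwartz; apply/funext => x; ring.
Qed.

(** Differentiation and multiplication by [xi] exchange the two kinds of transforms, so the class
    for [rs_class] must contain both. *)
Lemma rs_trig u : rschwartz u -> rschwartz (trig cos u) /\ rschwartz (trig sin u).
Proof.
move=> ru.
suff h v : rschwartz v -> forall w, (w = trig cos v \/ w = trig sin v) -> rschwartz w.
  by split; apply: (h u) => //; [left|right].
move=> rv w hw.
apply: (@rs_class R (fun w => exists v, rschwartz v /\ (w = trig cos v \/ w = trig sin v))); last by exists v.
move=> {}w [{}v [{}rv {}hw]].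
have rxv := rs_mulx rv; have rdv := rs_smooth_deriv rv.
have dc xi := trig_deriv dcos cos_bound Nsin_bound xi rv.
have ds xi := trig_deriv dsin sin_bound cos_bound xi rv.
case: hw => ->; split.
- by move=> xi; case: (dc xi).
- exists (fun x => - (x * v x)); split; first exact: rsN.
  right; rewrite (derive1_funE dc); apply/funext => xi.
  by rewrite trig_Nsin// trigN//; exact: continuous_sin.
- exists (fun x => - derive1 v x); split; first exact: rsN.
  right; apply/funext => xi; rewrite (trig_mul dsin (@continuous_cos R) sin_bound cos_bound)//.
  by rewrite trigN//; exact: continuous_sin.
- exists (\int[mu]_x `|v x|) => xi.
  exact: trig_bound (@continuous_cos R) cos_bound (rs_int rv).
- by move=> xi; case: (ds xi).
- exists (fun x => x * v x); split => //.
  by left; rewrite (derive1_funE ds).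
- exists (derive1 v); split => //; left; apply/funext => xi.
  apply: oppr_inj; rewrite -mulrN -trig_Nsin//.
  by rewrite (trig_mul dcos cNsin cos_bound Nsin_bound).
- exists (\int[mu]_x `|v x|) => xi.
  exact: trig_bound (@continuous_sin R) sin_bound (rs_int rv).
Qed.

End Transforms.

(** * Fourier inversion by Abel means *)

Section Inversion.
Context {R : realType}.
Local Notation mu := (@lebesgue_measure R).
Local Notation I f := (mu.-integrable [set: R] (EFin \o f)).
Implicit Types (u v h : R -> R) (x y xi d e : R) (n k : nat).

Let abel (e x : R) : R := expR (- (e * `|x|)).

Let abel_ge0 e x : 0 <= abel e x. Proof. exact: expR_ge0. Qed.

Let abel_cont e : continuous (abel e).
Proof.
move=> x; apply: (cvg_comp (fun x => - (e * `|x|)) expR); last exact: continuous_expR.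
by apply: cvgN; apply: cvgM; [exact: cvg_cst|exact: cvg_norm].
Qed.

(** From [exp (e |x|) >= (1 + e |x| / 2)^2 = (e^2 / 4) (2 / e + |x|)^2], where [2 / e >= 1]. *)
Lemma abel_weight e x : 0 < e -> e <= 1 -> abel e x <= 4 / e ^+ 2 * (oneDsqr x)^-1.
Proof.
move=> e0 e1; rewrite /abel expRN ler_pdivlMr ?(lt_le_trans _ (oneDsqr_ge1 x))//.
rewrite ler_pdivrMl ?expR_gt0// /oneDsqr.
have z0 : 0 <= e * `|x| / 2 by rewrite divr_ge0// mulr_ge0// ltW.
have h := expR_ge1Dx (e * `|x| / 2).
apply: (@le_trans _ _ ((1 + e * `|x| / 2) ^+ 2 * (4 / e ^+ 2))).
  have -> : (1 + e * `|x| / 2) ^+ 2 * (4 / e ^+ 2) = (2 / e + `|x|) ^+ 2.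
    by field; rewrite gt_eqF.
  have -> : x ^+ 2 = `|x| ^+ 2 by rewrite real_normK ?num_real.
  have : 1 <= 2 / e by rewrite ler_pdivlMr// mul1r (le_trans e1)// ler1n.
  have := normr_ge0 x; nra.
rewrite ler_wpM2r ?divr_ge0 ?sqr_ge0//.
have -> : expR (e * `|x|) = expR (e * `|x| / 2) ^+ 2.
  by rewrite expr2 -expRD; congr expR; field.
by rewrite ler_sqr ?nnegrE ?expR_ge0 ?addr_ge0.
Qed.

Lemma abel_int e : 0 < e -> e <= 1 -> I (abel e).
Proof.
move=> e0 e1; apply: (le_int _ _ (intZ (4 / e ^+ 2) integrable_oneDsqrV.1)).
  by apply: continuous_measurable_fun; exact: abel_cont.
by move=> x; rewrite ger0_norm// (le_trans (abel_weight x e0 e1))// ler_norm.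
Qed.

Lemma abel_kernel e d : 0 < e -> e <= 1 ->
  I (fun xi => abel e xi * cos (d * xi)) /\
  \int[mu]_xi (abel e xi * cos (d * xi)) = 2 * e / (e ^+ 2 + d ^+ 2).
Proof.
move=> e0 e1.
have cc : continuous (fun xi => cos (d * xi)).
  move=> x; apply: (cvg_comp (fun x => d * x) cos); last exact: continuous_cos.
  by apply: cvgM; [exact: cvg_cst|exact: cvg_id].
have cg : continuous (fun xi => abel e xi * cos (d * xi)).
  by move=> x; apply: cvgM; [exact: abel_cont|exact: cc].
have jg : I (fun xi => abel e xi * cos (d * xi)).
  apply: (le_int _ _ (abel_int e0 e1)); first exact: (continuous_measurable_fun cg).
  by move=> x; rewrite normrM ler_piMr ?cos_bound.
split => //; rewrite -(cvg_lim _ (Rint_sym cg jg))//; apply: cvg_lim => //.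
have p0 : 0 < e ^+ 2 + d ^+ 2 by rewrite ltr_pwDl ?exprn_gt0 ?sqr_ge0.
(* A primitive of [2 exp (- e x) cos (d x)], the integrand folded onto the half-line. It vanishes at
   infinity, and [- G 0] is the claimed value. *)
pose G x := 2 * (e ^+ 2 + d ^+ 2)^-1 * (expR (- (e * x)) * (d * sin (d * x) - e * cos (d * x))).
have E n : \int[mu]_(x in `[0, n%:R]) (abel e x * cos (d * x) + abel e (- x) * cos (d * - x)) =
    G n%:R - G 0.
  have n0 : 0 <= n%:R :> R by [].
  have [||_ <-] := @ftc R G (fun x => 2 * (expR (- (e * x)) * cos (d * x))) 0 n%:R n0.
  - move=> x _.
    have dG : exists g, is_derive x 1 G g /\ g = 2 * (expR (- (e * x)) * cos (d * x)).
      eexists; split; first by rewrite /G; der.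
      by rewrite /=; move: (expR _) (sin _) (cos _) => X S C; field; rewrite gt_eqF.
    by have [g [dg <-]] := dG.
  - move=> x _.
    by simple notypeclasses refine (der_cont _); [|der].
  apply: eq_Rintegral => x /set_mem; rewrite /= in_itv /= => /andP[x0 _].
  by rewrite /abel normrN ger0_norm// mulrN cosN; ring.
under eq_fun do rewrite E.
have G0 : - G 0 = 2 * e / (e ^+ 2 + d ^+ 2).
  by rewrite /G !mulr0 oppr0 expR0 sin0 cos0; ring.
have [M hM] : exists M : R, forall n, `|G n%:R| <= M * (oneDsqr n%:R)^-1.
  exists (2 * (e ^+ 2 + d ^+ 2)^-1 * (`|d| + e) * (4 / e ^+ 2)) => n.
  rewrite /G normrM (ger0_norm (ltW _)) ?mulr_gt0 ?invr_gt0// -!mulrA.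
  rewrite ler_wpM2l// ler_wpM2l ?invr_ge0 ?(ltW p0)// normrM mulrC ler_pM//.
    rewrite (le_trans (ler_normB _ _))// !normrM (gtr0_norm e0).
    by apply: lerD; [rewrite ler_piMr// sin_bound|rewrite ler_piMr ?(ltW e0)// cos_bound].
  have := abel_weight n%:R e0 e1; rewrite /abel ger0_norm// => h.
  by move: h; rewrite ?ger0_norm ?expR_ge0// mulrA.
have hG : G n%:R @[n --> \oo] --> 0.
  apply/cvgr0Pnorm_le => z z0.
  have /cvgr0_norm_le/(_ z z0) := @oneDsqrV_cvg0 R M.
  by apply: filterS => n h; rewrite (le_trans (hM n))// (le_trans (ler_norm _)).
have H : (G n%:R - G 0) @[n --> \oo] --> - G 0.
  by rewrite -[X in _ --> X]sub0r; apply: cvgB; [exact: hG|exact: cvg_cst].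
by rewrite -G0; exact: H.
Qed.

(** Peetre's inequality; it replaces a translation of the integration variable. *)
Lemma shift_weight x y : (oneDsqr (x - y))^-1 <= 2 * (1 + y ^+ 2) * (oneDsqr x)^-1.
Proof.
have px : 0 < 1 + x ^+ 2 by rewrite ltr_pwDl ?sqr_ge0.
have pxy : 0 < 1 + (x - y) ^+ 2 by rewrite ltr_pwDl ?sqr_ge0.
rewrite /oneDsqr ler_pdivlMr// ler_pdivrMl//.
have := sqr_ge0 ((x - y) - y); have := sqr_ge0 ((x - y) * y); nra.
Qed.

Let poisson e d : R := 2 * e / (e ^+ 2 + d ^+ 2).

Let poisson_ge0 e d : 0 < e -> 0 <= poisson e d.
Proof. by move=> e0; rewrite /poisson divr_ge0 ?mulr_ge0 ?addr_ge0 ?sqr_ge0// ltW. Qed.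

Let poisson_le e d : 0 < e -> e <= 1 -> poisson e d <= 2 / e * (oneDsqr d)^-1.
Proof.
move=> e0 e1; rewrite /poisson /oneDsqr.
have p : 0 < 1 + d ^+ 2 by rewrite ltr_pwDl ?sqr_ge0.
have q : 0 < e ^+ 2 + d ^+ 2 by rewrite ltr_pwDl ?exprn_gt0 ?sqr_ge0.
rewrite ler_pdivrMr// mulrAC ler_pdivlMr//.
have -> : 2 / e * (e ^+ 2 + d ^+ 2) = 2 * e + 2 * (d ^+ 2 / e) by field; rewrite gt_eqF.
rewrite mulrDr mulr1 lerD2l -mulrA ler_wpM2l// ler_pdivlMr//.
have h : e * e <= 1 by rewrite mulr_ile1// ltW.
by have := ler_wpM2l (sqr_ge0 d) h; lra.
Qed.

Let poisson_cont e y : 0 < e -> continuous (fun x => poisson e (x - y)).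
Proof.
move=> e0 x; rewrite /poisson.
simple notypeclasses refine (der_cont _); [|der] => //.
by rewrite gt_eqF// ltr_pwDl ?exprn_gt0 ?sqr_ge0.
Qed.

Let atan_lim y e : 0 < e -> atan ((n%:R - y) / e) @[n --> \oo] --> (pi / 2 : R).
Proof.
move=> e0; apply: (cvg_comp (fun n => (n%:R - y) / e) atan); last exact: cvgy_atan.
apply/cvgryPge => A.
have : \forall n \near \oo, A * e + y <= n%:R by exact: nbhs_infty_ger.
by apply: filterS => n; rewrite ler_pdivlMr// lerBrDr.
Qed.

Lemma poisson_integral e y : 0 < e -> e <= 1 ->
  I (fun x => poisson e (x - y)) /\ \int[mu]_x poisson e (x - y) = 2 * pi.
Proof.
move=> e0 e1.
have j : I (fun x => poisson e (x - y)).
  apply: (le_int _ _ (intZ (2 / e * (2 * (1 + y ^+ 2))) integrable_oneDsqrV.1)).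
    by apply: continuous_measurable_fun; exact: poisson_cont.
  move=> x; rewrite ger0_norm ?poisson_ge0// (le_trans (poisson_le _ e0 e1))//.
  rewrite (le_trans _ (ler_norm _))// -[leRHS]mulrA ler_wpM2l ?divr_ge0 ?(ltW e0)//.
  exact: shift_weight.
split => //; rewrite -(cvg_lim _ (Rint_expand j))//.
have E n : \int[mu]_(x in `[- n%:R, n%:R]) poisson e (x - y) =
    2 * atan ((n%:R - y) / e) + 2 * atan ((n%:R - (- y)) / e).
  have n0 : - n%:R <= n%:R :> R by rewrite (@le_trans _ _ 0)// oppr_le0.
  have [||_ ->] := @ftc R (fun x => 2 * atan ((x - y) / e)) (fun x => poisson e (x - y))
    (- n%:R) n%:R n0.
  - move=> x _.
    have dG : exists g, is_derive x 1 (fun x => 2 * atan ((x - y) / e)) g /\ g = poisson e (x - y).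
      eexists; split; first by der.
      rewrite /= /poisson; field.
      by rewrite !gt_eqF// ?ltr_pwDl ?exprn_gt0 ?sqr_ge0.
    by have [g [dg <-]] := dG.
  - by move=> x _; exact: poisson_cont.
  congr (_ + _); rewrite -mulrN -atanN; congr (2 * atan _); rewrite -mulNr; congr (_ / e); ring.
under eq_fun do rewrite E.
have H : 2 * atan ((n%:R - y) / e) + 2 * atan ((n%:R - (- y)) / e) @[n --> \oo] -->
    (2 * (pi / 2) + 2 * (pi / 2) : R).
  by apply: cvgD; apply: cvgM; (try exact: cvg_cst); exact: atan_lim.
by rewrite (cvg_lim _ H)//; field.
Qed.

Let ec n : R := n.+1%:R^-1.
Let ec0 n : 0 < ec n. Proof. by rewrite invr_gt0. Qed.
Let ec1 n : ec n <= 1. Proof. by rewrite invf_le1 ?ler1n. Qed.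
Let ec_cvg : ec n @[n --> \oo] --> 0. Proof. exact: cvg_harmonic. Qed.

Lemma rs_lipschitz u : rschwartz u -> exists2 M : R, 0 <= M & forall x y, `|u x - u y| <= M * `|x - y|.
Proof.
move=> ru; have [M0 hM0] := rs_bounded (rs_smooth_deriv ru).
exists M0; first exact: le_trans (hM0 0).
have h x y : y <= x -> `|u x - u y| <= M0 * `|x - y|.
  move=> yx.
  have [|c _ ->] := @MVT_segment R u (derive1 u) y x yx (fun z _ => smooth_derive0 z ru.1).
    exact: continuous_subspaceT (rs_cont ru).
  by rewrite normrM ler_wpM2r.
by move=> x y; have [/h//|/ltW/h] := leP y x; rewrite distrC (distrC y).
Qed.

(** After subtracting [u y] dominated convergence applies. With [d = |x - y|], for [d <= 1] the
    Lipschitz bound and [2 e d <= e^2 + d^2] cancel the singularity; for [d > 1] boundedness of [u]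
    suffices. The two cases account for [2 L] and [8 B]. *)
Lemma poisson_limit u y : rschwartz u ->
  \int[mu]_x (u x * poisson (ec n) (x - y)) @[n --> \oo] --> 2 * pi * u y.
Proof.
move=> ru.
have [L L0 uL] := rs_lipschitz ru.
have [B hB] := rs_bounded ru.
have B0 : 0 <= B by exact: le_trans (hB 0).
pose f_ n x := (u x - u y) * poisson (ec n) (x - y).
have mP n : measurable_fun [set: R] (fun x => poisson (ec n) (x - y)).
  by apply: continuous_measurable_fun; exact: poisson_cont.
have mf n : measurable_fun [set: R] (f_ n).
  by apply: measurable_funM => //; apply: measurable_funB => //; exact: rs_meas.
have jg := intZ ((2 * L + 8 * B) * (2 * (1 + y ^+ 2))) (@integrable_oneDsqrV R).1.
have [||j0 h] := @Rint_cvg R f_ (fun=> 0) _ mf _ jg.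
- move=> x; have [->|xy] := eqVneq x y.
    by rewrite /f_ subrr; under eq_fun do rewrite mul0r; exact: cvg_cst.
  rewrite -[X in _ --> X](mulr0 (u x - u y)); apply: cvgM; first exact: cvg_cst.
  rewrite /poisson -[X in _ --> X](mul0r ((0 ^+ 2 + (x - y) ^+ 2)^-1)).
  apply: cvgM.
    by rewrite -[X in _ --> X](mulr0 2); apply: cvgM; [exact: cvg_cst|exact: ec_cvg].
  apply: cvgV; first by rewrite expr0n /= add0r sqrf_eq0 subr_eq0.
  apply: cvgD; last exact: cvg_cst.
  by rewrite !expr2; apply: cvgM; exact: ec_cvg.
- move=> n x; rewrite /f_ normrM (ger0_norm (poisson_ge0 _ (ec0 n))).
  apply: (@le_trans _ _ ((2 * L + 8 * B) * (oneDsqr (x - y))^-1)); last first.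
    rewrite -mulrA ler_wpM2l ?shift_weight// addr_ge0// mulr_ge0//.
  move: (ec n) (ec0 n) (ec1 n) => e e0 e1.
  have dp : 0 < 1 + (x - y) ^+ 2 by rewrite ltr_pwDl ?sqr_ge0.
  have q : 0 < e ^+ 2 + (x - y) ^+ 2 by rewrite ltr_pwDl ?exprn_gt0 ?sqr_ge0.
  rewrite /oneDsqr ler_pdivlMr// /poisson mulrA mulrAC ler_pdivrMr//.
  have h1 : `|u x - u y| <= L * `|x - y| by exact: uL.
  have h2 : `|u x - u y| <= 2 * B.
    by rewrite (le_trans (ler_normB _ _))// mulr_natl mulr2n lerD.
  move: (`|u x - u y|) h1 h2 (normr_ge0 (u x - u y)) => U h1 h2 U0.
  have -> : (x - y) ^+ 2 = `|x - y| ^+ 2 by rewrite real_normK ?num_real.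
  move: (`|x - y|) h1 (normr_ge0 (x - y)) => d h1 d0.
  have LB : 0 <= L * (e ^+ 2 + d ^+ 2) by rewrite mulr_ge0// addr_ge0 ?sqr_ge0.
  have [d1|d1] := leP d 1.
    have k1 : 2 * e * d <= e ^+ 2 + d ^+ 2 by have := sqr_ge0 (e - d); lra.
    have k2 := ler_wpM2r (mulr_ge0 (ltW e0) (addr_ge0 ler01 (sqr_ge0 d))) h1.
    have k3 : d ^+ 2 <= 1 by rewrite expr_le1.
    have k4 : 0 <= B * (e ^+ 2 + d ^+ 2) by rewrite mulr_ge0// addr_ge0 ?sqr_ge0.
    have k5 : L * (2 * e * d) <= L * (e ^+ 2 + d ^+ 2) by rewrite ler_wpM2l.
    have k6 : L * (2 * e * d) * (1 + d ^+ 2) <= L * (e ^+ 2 + d ^+ 2) * (1 + d ^+ 2).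
      by rewrite ler_wpM2r// addr_ge0 ?sqr_ge0.
    have k7 := ler_wpM2l LB k3; lra.
  have k3 : 1 <= d ^+ 2 by rewrite expr_ge1// ltW.
  have k1 : U * (2 * e) <= 2 * B * 2 by apply: ler_pM => //; [rewrite mulr_ge0// ltW|lra].
  have k2 : U * (2 * e) * (1 + d ^+ 2) <= 2 * B * 2 * (1 + d ^+ 2).
    by rewrite ler_wpM2r// addr_ge0 ?sqr_ge0.
  have k4 : B * 1 <= B * d ^+ 2 by rewrite ler_wpM2l.
  have k5 : 0 <= B * e ^+ 2 by rewrite mulr_ge0 ?sqr_ge0.
  lra.
have Pj n := poisson_integral y (ec0 n) (ec1 n).
have E n : \int[mu]_x (u x * poisson (ec n) (x - y)) = \int[mu]_x f_ n x + u y * (2 * pi).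
  have [Pn <-] := Pj n; rewrite -(RintZ _ Pn) -RintD; last exact: intZ.
    by apply: eq_Rint => x; rewrite /f_ mulrBl subrK.
  apply: (le_int (mf n) _ (intZ (2 * B) Pn)) => x.
  rewrite /f_ normrM [leRHS]normrM ler_wpM2r// (le_trans (ler_normB _ _))//.
  by rewrite ger0_norm ?mulr_ge0// mulr_natl mulr2n lerD.
under eq_fun do rewrite E.
rewrite Rintegral_cst// mul0r in h.
have {}h : (\int[mu]_x f_ n x + u y * (2 * pi)) @[n --> \oo] --> 0 + u y * (2 * pi).
  by apply: cvgD; [exact: h|exact: cvg_cst].
by rewrite (mulrC _ (u y)); rewrite add0r in h; exact: h.
Qed.

(** The integrand is the integral over [x] of [cos ((x - y) xi) u x]. The Abel factor makes the
    double integral absolutely convergent, and integrating in [xi] first produces the Poisson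
    kernel. *)
Lemma trig_inversion u y : rschwartz u ->
  \int[mu]_xi (cos (y * xi) * trig cos u xi + sin (y * xi) * trig sin u xi) = 2 * pi * u y.
Proof.
move=> ru; have [rc rs] := rs_trig ru.
have ju := rs_int ru.
pose H xi := cos (y * xi) * trig cos u xi + sin (y * xi) * trig sin u xi.
have cy (T : R -> R) : continuous T -> continuous (fun xi => T (y * xi)).
  move=> cT x; apply: (cvg_comp (fun x => y * x) T); last exact: cT.
  by apply: cvgM; [exact: cvg_cst|exact: cvg_id].
have mcy := continuous_measurable_fun (cy _ (@continuous_cos R)).
have msy := continuous_measurable_fun (cy _ (@continuous_sin R)).
have jH : I H.
  by apply: intD; apply: int_bounded => //; exact: rs_int.
have cxi (T : R -> R) xi : continuous T -> continuous (fun x => T (x * xi)).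
  by move=> cT x; apply: (cvg_comp (fun x => x * xi) T); [exact: mulrr_continuous|exact: cT].
have HE xi : H xi = \int[mu]_x (cos ((x - y) * xi) * u x).
  have jc := trig_int xi (@continuous_cos R) cos_bound ju.
  have js := trig_int xi (@continuous_sin R) sin_bound ju.
  rewrite /H /trig -(RintZ _ jc) -(RintZ _ js) -(RintD (intZ _ jc) (intZ _ js)).
  by apply: eq_Rint => x; rewrite mulrBl cosB; ring.
have lim1 : \int[mu]_xi (abel (ec n) xi * H xi) @[n --> \oo] --> \int[mu]_xi H xi.
  have mH := int_meas jH.
  have [|||_ h] := @Rint_cvg R (fun n xi => abel (ec n) xi * H xi) H _ _ _ (integrable_norm jH).
  - move=> n; apply: measurable_funM => //.
    by apply: continuous_measurable_fun; exact: abel_cont.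
  - move=> xi; rewrite -[X in _ --> X]mul1r; apply: cvgM; last exact: cvg_cst.
    rewrite -expR0; apply: (cvg_comp (fun n => - (ec n * `|xi|)) expR); last exact: continuous_expR.
    have hz : - (ec n * `|xi|) @[n --> \oo] --> - (0 * `|xi|).
      by apply: cvgN; apply: cvgM; [exact: ec_cvg|exact: cvg_cst].
    by rewrite mul0r oppr0 in hz; exact: hz.
  - move=> n xi; rewrite normrM ler_piMl// ger0_norm//.
    by rewrite /abel -expR0 ler_expR oppr_le0 mulr_ge0// ltW.
  exact: h.
have E n : \int[mu]_xi (abel (ec n) xi * H xi) = \int[mu]_x (u x * poisson (ec n) (x - y)).
  pose k (z : R * R) := abel (ec n) z.2 * cos ((z.1 - y) * z.2) * u z.1.
  have mk : measurable_fun [set: R * R] k.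
    apply: measurable_funM; last by apply: measurableT_comp => //; exact: rs_meas.
    apply: measurable_funM.
      apply: measurableT_comp => //.
      by apply: continuous_measurable_fun; exact: abel_cont.
    apply: (measurableT_comp (continuous_measurable_fun (@continuous_cos R))).
    by apply: measurable_funM => //; exact: measurable_funB.
  have jk : (mu \x mu)%E.-integrable setT (EFin \o k).
    apply: (integrable_prod mk (integrable_norm ju) (abel_int (ec0 n) (ec1 n))) => x xi.
    rewrite /k /= normrM mulrC ler_wpM2l// normrM ger0_norm//.
    by rewrite ler_piMr// cos_bound.
  have [_ _ e] := Rintegral_fubini jk.
  transitivity (\int[mu]_y \int[mu]_x k (x, y)).
    apply: eq_Rint => xi; rewrite HE -RintZ; last first.
      apply: int_bounded => //.
      apply: (measurableT_comp (continuous_measurable_fun (@continuous_cos R))).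
      by apply: measurable_funM => //; exact: measurable_funB.
    by apply: eq_Rint => x; rewrite /k /= mulrA.
  rewrite -e; apply: eq_Rint => x.
  have [ja ea] := abel_kernel (x - y) (ec0 n) (ec1 n).
  by rewrite /poisson -ea -(RintZ _ ja); apply: eq_Rint => xi; rewrite /k /= mulrC.
rewrite -/H -(cvg_lim _ lim1)//.
under eq_fun do rewrite E.
by apply/cvg_lim => //; exact: poisson_limit.
Qed.

(** The imaginary part of the inversion formula for real [u]: the integrand is odd in [xi]. *)
Lemma trig_inversion0 u y : rschwartz u ->
  \int[mu]_xi (cos (y * xi) * trig sin u xi - sin (y * xi) * trig cos u xi) = 0.
Proof.
move=> ru; have [rc rs] := rs_trig ru.
have cy (T : R -> R) : continuous T -> continuous (fun xi => T (y * xi)).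
  move=> cT x; apply: (cvg_comp (fun x => y * x) T); last exact: cT.
  by apply: cvgM; [exact: cvg_cst|exact: cvg_id].
have cc := cy _ (@continuous_cos R); have cs := cy _ (@continuous_sin R).
apply: Rint_odd.
- move=> x; apply: cvgB; apply: cvgM.
  + exact: cc.
  + exact: (rs_cont rs).
  + exact: cs.
  + exact: (rs_cont rc).
- apply: intB; apply: int_bounded => //; try exact: rs_int.
  + exact: (continuous_measurable_fun cc).
  + exact: (continuous_measurable_fun cs).
move=> xi.
have -> : trig sin u (- xi) = - trig sin u xi.
  rewrite -trig_Nsin//; apply: eq_Rint => x; rewrite mulrN sinN //.
have -> : trig cos u (- xi) = trig cos u xi.
  by apply: eq_Rint => x; rewrite mulrN cosN.
by rewrite !mulrN cosN sinN; ring.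
Qed.

End Inversion.

(** * Pairing the limit with Schwartz functions *)

Section Pairing.
Context {R : realType}.
Local Notation mu := (@lebesgue_measure R).
Local Notation I f := (mu.-integrable [set: R] (EFin \o f)).
Context (a b D : R -> R).
Hypotheses (ma : measurable_fun [set: R] a) (mb : measurable_fun [set: R] b)
  (iD : mu.-integrable [set: R] (EFin \o D)) (D0 : forall xi, 0 <= D xi)
  (abD : forall xi, (`|a xi| <= D xi /\ `|b xi| <= D xi) \/
    (a xi ^+ 2 + b xi ^+ 2 <= D xi /\
     (a xi ^+ 2 + b xi ^+ 2) * Num.sqrt `|xi| <= D xi)).

Lemma adj_trig (N c : R) (u T : R -> R) xi :
  I (fun x => T (x * xi) * u x) ->
  adj (-1) (cst 0) (cst N) (fun x => c * u x) T xi = c * (band (-1) N xi * trig T u xi).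
Proof.
move=> j; rewrite /adj /trig mulrA -(RintZ _ j); apply: eq_Rint => x.
by rewrite /wave /= mul0r subr0; ring.
Qed.

(** The duality of the linearized operator, at time 0 and with constant truncation; its adjoint is
    then a truncated cosine or sine transform. The factor [c] only normalizes [u] below the
    weight. *)
Lemma osum_pairing N u : rschwartz u ->
  [/\ I (fun x => u x * osum a b (-1) N 0 x),
   I (fun xi => band (-1) N xi * (a xi * trig cos u xi - b xi * trig sin u xi)) &
  \int[mu]_x (u x * osum a b (-1) N 0 x) =
  \int[mu]_xi (band (-1) N xi * (a xi * trig cos u xi - b xi * trig sin u xi))].
Proof.
move=> ru; have [M M0 uM] := rs_weight ru.
pose c := (M + 1)^-1.
have M1 : 0 < M + 1 by rewrite ltr_wpDl.
have c0 : 0 < c by rewrite invr_gt0.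
have ju := rs_int ru.
have mw : measurable_fun [set: R] (fun x => c * u x) by apply: measurable_funM => //; exact: rs_meas.
have wW x : `|c * u x| <= (oneDsqr x)^-1.
  rewrite normrM (gtr0_norm c0) ler_pdivrMl// (le_trans (uM x))// ler_wpM2r ?invr_ge0// lerDl//.
have N1 (x : R) : cst N x <= N by [].
have m0 : measurable_fun [set: R] (cst (0 : R)) := measurable_cst _.
have mN : measurable_fun [set: R] (cst N) := measurable_cst N.
have [h1 h2] := integrable_osum ma mb iD D0 abD (-1) m0 mN mw N1 wW.
have jc xi := trig_int xi (@continuous_cos R) (@cos_bound R) ju.
have js xi := trig_int xi (@continuous_sin R) (@sin_bound R) ju.
have ia := integrable_density_band iD D0 (-1) N ma (fun xi => (density_bound abD xi).1).
have ib := integrable_density_band iD D0 (-1) N mb (fun xi => (density_bound abD xi).2).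
have [a1 _ _] := adj_duality m0 mN mw N1 wW (@measurable_cos R) (@cos_bound R) ma ia.
have [b1 _ _] := adj_duality m0 mN mw N1 wW (@measurable_sin R) (@sin_bound R) mb ib.
have E1 x : (M + 1) * (c * u x * osum a b (-1) N 0 x) = u x * osum a b (-1) N 0 x.
  by rewrite !mulrA mulfV ?gt_eqF// mul1r.
have E2 xi : (M + 1) * (a xi * adj (-1) (cst 0) (cst N) (fun x => c * u x) cos xi -
      b xi * adj (-1) (cst 0) (cst N) (fun x => c * u x) sin xi) =
    band (-1) N xi * (a xi * trig cos u xi - b xi * trig sin u xi).
  rewrite (adj_trig _ _ (jc xi)) (adj_trig _ _ (js xi)) /c; field.
  by rewrite gt_eqF.
split.
- exact: eq_int E1 (intZ _ h1).
- exact: eq_int E2 (intZ _ (intB a1 b1)).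
- by rewrite -(eq_Rint E1) -(eq_Rint E2) (RintZ _ h1) (RintZ _ (intB a1 b1)) h2.
Qed.

Lemma limit_pairing F u : rschwartz u ->
  measurable_fun [set: R] F ->
  I (fun x => (oneDsqr x)^-1 * F x) ->
  \int[mu]_x ((oneDsqr x)^-1 * `|F x - osum a b (-1) n.+1%:R 0 x|) @[n --> \oo] --> 0 ->
  I (fun x => u x * F x) /\
  \int[mu]_xi (band (-1) n.+1%:R xi * (a xi * trig cos u xi - b xi * trig sin u xi))
   @[n --> \oo] --> \int[mu]_x (u x * F x).
Proof.
move=> ru mF jF F0; have [M M0 uM] := rs_weight ru.
have W0 (x : R) : 0 <= (oneDsqr x)^-1 by rewrite invr_ge0.
have juF : I (fun x => u x * F x).
  apply: (le_int _ _ (intZ M jF)).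
    by apply: measurable_funM => //; exact: rs_meas.
  by move=> x; rewrite normrM mulrA normrM ler_wpM2r// (le_trans (uM x))// ler_norm.
split; first exact: juF.
have jX n := osum_pairing n.+1%:R ru.
have W1 (x : R) : `|(oneDsqr x)^-1| <= (oneDsqr x)^-1 by rewrite ger0_norm.
have jWX n : I (fun x => (oneDsqr x)^-1 * osum a b (-1) n.+1%:R 0 x).
  by apply: (@integrable_osum R a b D ma mb iD D0 abD (-1) n.+1%:R (cst 0) (cst n.+1%:R)
    (fun x => (oneDsqr x)^-1) _ _ measurable_oneDsqrV _ W1).1 => //; exact: measurable_cst.
have jd n : I (fun x => (oneDsqr x)^-1 * `|F x - osum a b (-1) n.+1%:R 0 x|).
  apply: eq_int (integrable_norm (intB jF (jWX n))) => x /=.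
  by rewrite -mulrBr normrM ger0_norm.
apply/cvgrPdist_le => e e0.
have e1 : 0 < e / (M + 1) by rewrite divr_gt0// ltr_wpDl.
have /cvgr0_norm_le/(_ _ e1) := F0; apply: filterS => n hn.
have [j1 _ <-] := jX n; rewrite -(RintB juF j1).
apply: (@le_trans _ _ (\int[mu]_x (M * ((oneDsqr x)^-1 * `|F x - osum a b (-1) n.+1%:R 0 x|)))).
  apply: (normr_Rint (intB juF j1) (intZ M (jd n))) => x.
  by rewrite -mulrBr normrM mulrA ler_wpM2r.
rewrite (RintZ _ (jd n)).
have h : \int[mu]_x ((oneDsqr x)^-1 * `|F x - osum a b (-1) n.+1%:R 0 x|) <= e / (M + 1).
  exact: le_trans (ler_norm _) hn.
apply: (le_trans (ler_wpM2l M0 h)); rewrite mulrCA ler_piMr ?(ltW e0)//.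
by rewrite ler_pdivrMr ?ltr_wpDl// mul1r lerDl.
Qed.

End Pairing.

Section BandLimit.
Context {R : realType}.
Local Notation mu := (@lebesgue_measure R).
Local Notation I f := (mu.-integrable [set: R] (EFin \o f)).

Lemma band_limit (h : R -> R) : I h ->
  \int[mu]_xi (band (-1) n.+1%:R xi * h xi) @[n --> \oo] --> \int[mu]_xi h xi.
Proof.
move=> jh.
have [|||_ H] := @Rint_cvg R (fun n xi => band (-1) n.+1%:R xi * h xi) h _ _ _ (integrable_norm jh).
- by move=> n; apply: measurable_funM; [exact: measurable_band|exact: int_meas].
- move=> xi; apply: cvg_near_cst.
  have : \forall n \near \oo, `|xi| <= n%:R by exact: nbhs_infty_ger.
  apply: filterS => n xn; rewrite /band (lt_le_trans _ (normr_ge0 xi))//=.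
  by rewrite (le_trans xn) ?ler_nat// mul1r.
- by move=> n xi; rewrite normrM ger0_norm ?band_ge0// ler_piMl// band_le1.
exact: H.
Qed.

End BandLimit.

(** * Fourier-Lebesgue data *)

Section Density.
Context {R : realType}.
Local Notation mu := (@lebesgue_measure R).
Local Notation I f := (mu.-integrable [set: R] (EFin \o f)).

(** A power [q >= 1] increases [A y >= 1], and a power [q <= 2] dominates the square of [A y < 1];
    then one divides by [A]. *)
Lemma powR_two_regimes (A y d q : R) : 1 <= A -> 0 <= y -> 0 <= d -> 1 <= q -> q <= 2 ->
  d * A = (A * y) `^ q -> y <= d \/ A * y ^+ 2 <= d.
Proof.
move=> A1 y0 d0 q1 q2 E; have A0 : 0 < A by rewrite (lt_le_trans ltr01).
have [h|h] := leP 1 (A * y).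
  by left; rewrite -(ler_pM2r A0) E mulrC; exact: le1r_powR.
right; have [->|yn] := eqVneq y 0; first by rewrite expr0n/= mulr0.
have Ay : 0 < A * y by rewrite mulr_gt0// lt_neqAle eq_sym yn.
rewrite -(ler_pM2r A0) E (_ : A * y ^+ 2 * A = (A * y) ^+ 2); last by ring.
rewrite -powR_mulrn ?(ltW Ay)//; apply: ger_powR q2; rewrite Ay/=; exact: ltW.
Qed.

Lemma Lnorm_integrable (q : R) (h : R -> R) : 0 < q -> measurable_fun [set: R] h ->
  (forall x, 0 <= h x) ->
  (Lnorm mu q%:E (EFin \o h) < +oo)%E -> I (fun x => h x `^ q).
Proof.
move=> q0 mh h0; rewrite Lnorm.unlock.
have mq : measurable_fun [set: R] (fun x => h x `^ q).
  exact: (measurableT_comp (measurable_powR q) mh).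
move=> H; apply/integrableP; split; first by apply/measurable_EFinP; exact: mq.
have -> : (\int[mu]_x `|(EFin \o (fun y => h y `^ q)%R) x| = \int[mu]_x (`|(EFin \o h) x| `^ q))%E.
  by apply: eq_integral => x _ /=; rewrite !ger0_norm ?powR_ge0// ?h0.
rewrite ltey; apply/eqP => E; move: H; rewrite /= E poweRyr ?invr_neq0 ?gt_eqF//.
Qed.

(** The conjugate exponent of [p / 2] is [q = p / (p - 2)], and [q <= 2] is exactly [4 <= p]. *)
Lemma fourier_lebesgue_density (p : R) f : 4 <= p ->
  fourier_lebesgue p^-1 (p / 2)%:E f ->
  let a xi := complex.Re (fhat f xi) in let b xi := complex.Im (fhat f xi) in
  exists D, [/\ I D, forall xi, 0 <= D xi & forall xi, (`|a xi| <= D xi /\ `|b xi| <= D xi) \/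
    (a xi ^+ 2 + b xi ^+ 2 <= D xi /\ (a xi ^+ 2 + b xi ^+ 2) * Num.sqrt `|xi| <= D xi)].
Proof.
move=> p4 [_ [[ma mb] _] Lf] a b.
have p0 : 0 < p by lra.
have p2 : 0 < p - 2 by lra.
pose q := p / (p - 2).
have q1 : 1 <= q by rewrite /q ler_pdivlMr//; lra.
have q2 : q <= 2 by rewrite /q ler_pdivrMr//; lra.
have ph : 0 < p / 2 by rewrite divr_gt0.
have ph2 : 0 < (p-2) / 2 by rewrite divr_gt0.
have Eq : hoelder_conjugate (p / 2)%:E = q%:E.
  rewrite /hoelder_conjugate eqe (gt_eqF ph)/= inver.
  have -> : p / 2 - 1 = (p - 2) / 2 by field.
  rewrite (gt_eqF ph2)/= -EFinM /q; congr EFin; field; lra.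
pose y xi := cabs (fhat f xi).
have yE xi : y xi = Num.sqrt (a xi ^+ 2 + b xi ^+ 2).
  by rewrite /y /cabs /a /b; case: (fhat f xi).
have y0 xi : 0 <= y xi by rewrite yE sqrtr_ge0.
have y2 xi : y xi ^+ 2 = a xi ^+ 2 + b xi ^+ 2.
  by rewrite yE sqr_sqrtr// addr_ge0// sqr_ge0.
have ay xi : `|a xi| <= y xi /\ `|b xi| <= y xi.
  by rewrite yE -!sqrtr_sqr; split; apply: ler_wsqrtr; rewrite ?lerDl ?lerDr sqr_ge0.
pose h xi := japanese_bracket p^-1 xi * y xi.
have h0 xi : 0 <= h xi by rewrite mulr_ge0 ?powR_ge0.
have mh : measurable_fun [set: R] h.
  apply: measurable_funM.
    apply: (measurableT_comp (measurable_powR _)) => //.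
    by apply: measurable_funD => //; apply: measurable_funX.
  rewrite (_ : y = fun xi => (a xi ^+ 2 + b xi ^+ 2) `^ 2^-1); last first.
    by apply/funext => xi; rewrite powR12_sqrt ?yE// addr_ge0// sqr_ge0.
  apply: (measurableT_comp (measurable_powR _)).
  by apply: measurable_funD; apply: measurable_funX.
exists (fun xi => h xi `^ q); split; first 2 last.
- move=> xi; pose w := 1 + xi ^+ 2; have w1 : 1 <= w by rewrite /w lerDl sqr_ge0.
  pose A := w `^ (4^-1).
  have w0 : w != 0 by rewrite gt_eqF// (lt_le_trans ltr01).
  have A1 : 1 <= A by rewrite -[1](powRr0 w) /A ler_powR// invr_ge0.
  have Axi : Num.sqrt `|xi| <= A.
    rewrite /A (_ : 4^-1 = 2^-1 * 2^-1 :> R); last by field.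
    rewrite powRrM !powR12_sqrt ?(le_trans ler01 w1) ?sqrtr_ge0//.
    by rewrite ler_wsqrtr// -sqrtr_sqr ler_wsqrtr// /w lerDr.
  have [|l|l] := @powR_two_regimes A (y xi) (h xi `^ q) q A1 (y0 xi) (powR_ge0 _ _) q1 q2.
  (* For the exponents of [1 + xi^2] the claim is [1 / (2 (p - 2)) + 1 / 4 = p / (4 (p - 2))]. *)
  + rewrite /h /japanese_bracket !powRM ?powR_ge0// /A -!powRrM mulrAC -powRD ?w0 ?implybT//.
    congr (_ `^ _ * _); rewrite /q; field; lra.
  + by left; split; [exact: le_trans (ay xi).1 l|exact: le_trans (ay xi).2 l].
  + right; rewrite -y2; split; apply: le_trans l.
      by rewrite ler_peMl// sqr_ge0.
    by rewrite mulrC ler_wpM2r// sqr_ge0.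
- apply: Lnorm_integrable => //; first lra.
  by move: Lf; rewrite /fourier_lebesgue_norm Eq.
- by move=> xi; exact: powR_ge0.
Qed.

End Density.

Section ComplexLimit.
Context {R : realType}.

Lemma cvg_complex {T : Type} (G : set_system T) {FG : Filter G} (u v : T -> R) (l m : R) :
  u @ G --> l -> v @ G --> m ->
  (fun x => (u x +i* v x : R[i]^o)) @ G --> (l +i* m : R[i]^o).
Proof.
move=> /cvgrPdist_le ul /cvgrPdist_le vm; apply/cvgrPdist_le => -[e ei].
rewrite ltcE/= => /andP[/eqP -> e0].
have e1 : 0 < e / 2 by rewrite divr_gt0.
near=> x.
have h1 : `|l - u x| <= e / 2 by near: x; exact: ul.
have h2 : `|m - v x| <= e / 2 by near: x; exact: vm.
rewrite normc_def lecR /=.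
apply: (@le_trans _ _ (`|l - u x| + `|m - v x|)); last lra.
rewrite -[leRHS]ger0_norm ?addr_ge0// -sqrtr_sqr ler_wsqrtr// [leRHS]sqrrD !real_normK ?num_real//.
by rewrite lerD2r lerDl mulrn_wge0// mulr_ge0.
Unshelve. all: by end_near. Qed.

End ComplexLimit.

Section Truncated.
Context {R : realType}.
Local Notation mu := (@lebesgue_measure R).

Lemma Rint_band (h : R -> R) N : 
  \int[mu]_(xi in `[- N, N]) h xi = \int[mu]_xi (band (-1) N xi * h xi).
Proof.
rewrite Rintegral_mkcond; apply: eq_Rint => xi; rewrite patchE /band.
rewrite (lt_le_trans _ (normr_ge0 xi)) ?ltrN10//= mem_setE in_itv/= ler_norml.
by case: ifP => _; rewrite ?mul1r ?mul0r.
Qed.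

Lemma realcM (r u v : R) : r%:C * (u +i* v) = (r * u) +i* (r * v).
Proof. by apply/eqP; rewrite eq_complex /= !mul0r subr0 addr0 !eqxx. Qed.

(** An imaginary part is the real part after multiplication by [- i], which turns [a + i b] into
    [b - i a]; one real operator thus covers both components. *)
Lemma schrodinger_truncE (f : (R -> R[i]) -> R[i]) t x N :
  let a xi := complex.Re (fhat f xi) in let b xi := complex.Im (fhat f xi) in
  let c := (Num.sqrt (2 * pi))^-1 in
  schrodinger_trunc f t x N =
   (c * osum a b (-1) N t x) +i* (c * osum b (fun xi => - a xi) (-1) N t x).
Proof.
move=> a b c; rewrite /schrodinger_trunc /cintegral !Rint_band -/c realcM.
congr (_ * _ +i* (_ * _)); apply: eq_Rint => xi; rewrite /wave /a /b;
  case: (fhat f xi) => p q /=; ring.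
Qed.

End Truncated.

Section ComplexSchwartz.
Context {R : realType}.
Local Notation mu := (@lebesgue_measure R).
Local Notation I f := (mu.-integrable [set: R] (EFin \o f)).
Implicit Types u v : R -> R.

Lemma Re_cabs (z : R[i]) : `|complex.Re z| <= cabs z.
Proof. by case: z => a b; rewrite -sqrtr_sqr ler_wsqrtr//= lerDl sqr_ge0. Qed.

Lemma Im_cabs (z : R[i]) : `|complex.Im z| <= cabs z.
Proof. by case: z => a b; rewrite -sqrtr_sqr ler_wsqrtr//= lerDr sqr_ge0. Qed.

Lemma cabs_ReIm (a b : R) : cabs (a +i* b) <= `|a| + `|b|.
Proof.
rewrite -[leRHS]ger0_norm ?addr_ge0// -sqrtr_sqr ler_wsqrtr//.
by rewrite [leRHS]sqrrD !real_normK ?num_real// lerD2r lerDl mulrn_wge0// mulr_ge0.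
Qed.

Lemma schwartz_ReIm (phi : R -> R[i]) : schwartz phi ->
  rschwartz (fun x => complex.Re (phi x)) /\ rschwartz (fun x => complex.Im (phi x)).
Proof.
move=> [s1 s2 H]; split; split => // k n; have [M hM] := H k n; exists M => x;
  apply: le_trans (hM x); rewrite ler_wpM2l ?exprn_ge0//.
- exact: Re_cabs (cderive1n n phi x).
- exact: Im_cabs (cderive1n n phi x).
Qed.

Lemma schwartz_complex u v : rschwartz u -> rschwartz v -> schwartz (fun x => u x +i* v x).
Proof.
move=> [su hu] [sv hv]; split; [exact: su|exact: sv|move=> k n].
have [M hM] := hu k n; have [K hK] := hv k n; exists (M + K) => x.
apply: (@le_trans _ _ (`|x| ^+ k * (`|derive1n n u x| + `|derive1n n v x|))).
  by rewrite ler_wpM2l ?exprn_ge0//; exact: cabs_ReIm.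
by rewrite mulrDr; exact: lerD.
Qed.

Lemma fourier_complex u v xi : 
  fourier (fun x => u x +i* v x) xi =
  ((Num.sqrt (2 * pi))^-1 * \int[mu]_x (cos (xi * x) * u x + sin (xi * x) * v x)) +i*
  ((Num.sqrt (2 * pi))^-1 * \int[mu]_x (cos (xi * x) * v x - sin (xi * x) * u x)).
Proof.
rewrite /fourier /cintegral realcM; congr (_ * _ +i* (_ * _)); apply: eq_Rint => x;
  rewrite /expi /= cosN sinN mulrC; rewrite [xi * x]mulrC; ring.
Qed.

(** [p + i q] is the inverse Fourier transform of [u + i v]. The hypothesis on [fhat f] gives the
    values of [f] at Fourier transforms of Schwartz functions only, so a test function must be put
    in this form. *)
Lemma fourier_preimage u v : rschwartz u -> rschwartz v ->
  let c : R := (Num.sqrt (2 * pi))^-1 in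
  let p xi := c * (trig cos u xi - trig sin v xi) in
  let q xi := c * (trig sin u xi + trig cos v xi) in
  [/\ rschwartz p, rschwartz q & fourier (fun xi => p xi +i* q xi) = fun x => u x +i* v x].
Proof.
move=> ru rv c p q.
have [ucos usin] := rs_trig ru; have [vcos vsin] := rs_trig rv.
have rZ (k : R) (w : R -> R) : rschwartz w -> rschwartz (fun x => k * w x).
  move=> rw; have := rs_lin (k - 1) rw rw.
  by rewrite (_ : (fun x => (k - 1) * w x + w x) = fun x => k * w x)//; apply/funext => x; ring.
have rp : rschwartz p.
  have := rZ c _ (rs_lin (-1) vsin ucos).
  by rewrite (_ : (fun x => c * (-1 * trig sin v x + trig cos u x)) = p)//; apply/funext => x; rewrite /p; ring.
have rq : rschwartz q.
  have := rZ c _ (rs_lin 1 usin vcos).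
  by rewrite (_ : (fun x => c * (1 * trig sin u x + trig cos v x)) = q)//; apply/funext => x; rewrite /q; ring.
split; [exact: rp|exact: rq|].
have c2 : c * c * (2 * pi) = 1.
  by rewrite /c -expr2 exprVn sqr_sqrtr ?mulr_ge0 ?pi_ge0// mulVf// mulf_neq0// gt_eqF// pi_gt0.
have cc z : c * (c * (2 * pi * z)) = z.
  by transitivity (c * c * (2 * pi) * z); [ring|rewrite c2 mul1r].
have jc (w : R -> R) y : rschwartz w -> I (fun x => cos (y * x) * w x).
  move=> rw; apply: eq_int (trig_int y (@continuous_cos R) (@cos_bound R) (rs_int rw)) => x.
  by rewrite mulrC [x * y]mulrC mulrC.
have js (w : R -> R) y : rschwartz w -> I (fun x => sin (y * x) * w x).
  move=> rw; apply: eq_int (trig_int y (@continuous_sin R) (@sin_bound R) (rs_int rw)) => x.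
  by rewrite mulrC [x * y]mulrC mulrC.
apply/funext => y; rewrite fourier_complex -/c; congr (_ +i* _).
- have E x : c * ((cos (y * x) * trig cos u x + sin (y * x) * trig sin u x) -
      (cos (y * x) * trig sin v x - sin (y * x) * trig cos v x)) =
      cos (y * x) * p x + sin (y * x) * q x by rewrite /p /q; ring.
  have j1 := intD (jc _ y ucos) (js _ y usin).
  have j2 := intB (jc _ y vsin) (js _ y vcos).
  rewrite -(eq_Rint E) (RintZ _ (intB j1 j2)) (RintB j1 j2) (trig_inversion _ ru) (trig_inversion0 _ rv).
  by rewrite subr0 cc.
- have E x : c * ((cos (y * x) * trig sin u x - sin (y * x) * trig cos u x) +
      (cos (y * x) * trig cos v x + sin (y * x) * trig sin v x)) =
      cos (y * x) * q x - sin (y * x) * p x by rewrite /p /q; ring.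
  have j1 := intB (jc _ y usin) (js _ y ucos).
  have j2 := intD (jc _ y vcos) (js _ y vsin).
  rewrite -(eq_Rint E) (RintZ _ (intD j1 j2)) (RintD j1 j2) (trig_inversion _ rv) (trig_inversion0 _ ru).
  by rewrite add0r cc.
Qed.

(** Integrability over the whole line is available only for the combination, not for [h1] and [h2]
    separately, so the splitting is done on bands before passing to the limit. *)
Lemma pairing_combine (c e A B : R) h1 h2 :
  (forall N, I (fun xi => band (-1) N xi * h1 xi)) ->
  (forall N, I (fun xi => band (-1) N xi * h2 xi)) ->
  I (fun xi => c * (h1 xi + e * h2 xi)) ->
  \int[mu]_xi (band (-1) n.+1%:R xi * h1 xi) @[n --> \oo] --> A ->
  \int[mu]_xi (band (-1) n.+1%:R xi * h2 xi) @[n --> \oo] --> B ->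
  \int[mu]_xi (c * (h1 xi + e * h2 xi)) = c * (A + e * B).
Proof.
move=> j1 j2 jh A1 B1; have L := band_limit jh.
have E n : c * (\int[mu]_xi (band (-1) n.+1%:R xi * h1 xi) +
    e * \int[mu]_xi (band (-1) n.+1%:R xi * h2 xi)) =
  \int[mu]_xi (band (-1) n.+1%:R xi * (c * (h1 xi + e * h2 xi))).
  rewrite -(RintZ _ (j2 _)) -(RintD (j1 _) (intZ _ (j2 _))) -(RintZ _ (intD (j1 _) (intZ _ (j2 _)))).
  by apply: eq_Rint => xi; ring.
have H : c * (\int[mu]_xi (band (-1) n.+1%:R xi * h1 xi) +
    e * \int[mu]_xi (band (-1) n.+1%:R xi * h2 xi)) @[n --> \oo] --> c * (A + e * B).
  apply: cvgM; first exact: cvg_cst.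
  by apply: cvgD; [exact: A1|apply: cvgM; [exact: cvg_cst|exact: B1]].
rewrite (eq_cvg _ _ E) in H.
by rewrite -(cvg_lim (@norm_hausdorff _ _) L) -(cvg_lim (@norm_hausdorff _ _) H).
Qed.

End ComplexSchwartz.

(** * The limit as a representative of the distribution *)

Section Main.
Context {R : realType}.
Local Notation mu := (@lebesgue_measure R).
Local Notation I f := (mu.-integrable [set: R] (EFin \o f)).

Lemma schrodinger_cvg (f : (R -> R[i]) -> R[i]) x (l1 l2 : R -> R) :
  let a xi := complex.Re (fhat f xi) in let b xi := complex.Im (fhat f xi) in
  let c := (Num.sqrt (2 * pi))^-1 in
  (forall t, osum a b (-1) N t x @[N --> +oo] --> l1 t) ->
  (forall t, osum b (fun xi => - a xi) (-1) N t x @[N --> +oo] --> l2 t) ->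
  l1 t @[t --> (0:R)^'] --> l1 0 -> l2 t @[t --> (0:R)^'] --> l2 0 ->
  (forall t, schrodinger_defined f t x) /\
  schrodinger f t x @[t --> (0 : R)^'] --> ((c * l1 0) +i* (c * l2 0) : R[i]^o).
Proof.
move=> a b c h1 h2 k1 k2.
have H t : schrodinger_trunc f t x N @[N --> +oo] --> ((c * l1 t) +i* (c * l2 t) : R[i]^o).
  rewrite (eq_cvg _ _ (schrodinger_truncE f t x)).
  by apply: cvg_complex; apply: cvgM; [exact: cvg_cst|exact: h1|exact: cvg_cst|exact: h2].
split; first by move=> t; apply/cvg_ex; eexists; exact: H t.
have E t : schrodinger f t x = (c * l1 t) +i* (c * l2 t).
  by apply: cvg_lim; [exact: norm_hausdorff|exact: H].
rewrite (eq_cvg _ _ E).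
by apply: cvg_complex; apply: cvgM; [exact: cvg_cst|exact: k1|exact: cvg_cst|exact: k2].
Qed.

Section Distribution.
Context (f : (R -> R[i]) -> R[i]) (D F1 F2 : R -> R).
Let a xi := complex.Re (fhat f xi).
Let b xi := complex.Im (fhat f xi).
Let a' xi := - a xi.
Let c : R := (Num.sqrt (2 * pi))^-1.
Hypotheses (iD : I D) (D0 : forall xi, 0 <= D xi)
  (abD : forall xi, (`|a xi| <= D xi /\ `|b xi| <= D xi) \/
    (a xi ^+ 2 + b xi ^+ 2 <= D xi /\
     (a xi ^+ 2 + b xi ^+ 2) * Num.sqrt `|xi| <= D xi))
  (ff : is_function (fourier_distribution f) (fhat f))
  (mF1 : measurable_fun [set: R] F1) (mF2 : measurable_fun [set: R] F2)
  (iF1 : I (fun x => (oneDsqr x)^-1 * F1 x)) (iF2 : I (fun x => (oneDsqr x)^-1 * F2 x))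
  (F1c : \int[mu]_x ((oneDsqr x)^-1 * `|F1 x - osum a b (-1) n.+1%:R 0 x|) @[n --> \oo] --> 0)
  (F2c : \int[mu]_x ((oneDsqr x)^-1 * `|F2 x - osum b a' (-1) n.+1%:R 0 x|) @[n --> \oo] --> 0).

Lemma density_rot xi : (`|b xi| <= D xi /\ `|a' xi| <= D xi) \/
    (b xi ^+ 2 + a' xi ^+ 2 <= D xi /\
     (b xi ^+ 2 + a' xi ^+ 2) * Num.sqrt `|xi| <= D xi).
Proof.
rewrite /a' normrN sqrrN addrC.
by have [[h1 h2]|h] := abD xi; [left|right].
Qed.

(** With the test function written as a Fourier transform, [f phi] is an integral of [fhat f]
    against cosine and sine transforms of its components. On bands each such integral is a pairing
    with a truncated integral, whose limit is the pairing with [F1] or [F2]. *)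
Lemma distribution_is_limit : is_function f (fun x => (c * F1 x) +i* (c * F2 x)).
Proof.
have [[ma mb] fE] := ff.
have ma' : measurable_fun [set: R] a' by apply: measurableT_comp => //; exact: ma.
have mcF F : measurable_fun [set: R] F -> measurable_fun [set: R] (fun x => c * F x).
  by move=> mF; apply: measurable_funM => //; exact: measurable_cst.
split; first by split; exact: mcF.
move=> phi sphi; have [ru rv] := schwartz_ReIm sphi.
set u := (fun x => complex.Re (phi x)) in ru.
set v := (fun x => complex.Im (phi x)) in rv.
have [rp rq fpq] := fourier_preimage ru rv.
have [[j1 j2]] := fE _ (schwartz_complex rp rq).
rewrite /fourier_distribution fpq.
have -> : (fun x => u x +i* v x) = phi by apply/funext => x; rewrite /u /v; case: (phi x).
move=> ->.
have [uF1 cu1] := limit_pairing ma mb iD D0 abD ru mF1 iF1 F1c.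
have [vF1 cv1] := limit_pairing ma mb iD D0 abD rv mF1 iF1 F1c.
have [uF2 cu2] := limit_pairing mb ma' iD D0 density_rot ru mF2 iF2 F2c.
have [vF2 cv2] := limit_pairing mb ma' iD D0 density_rot rv mF2 iF2 F2c.
have bu1 N := let: And3 _ h _ := osum_pairing ma mb iD D0 abD N ru in h.
have bv1 N := let: And3 _ h _ := osum_pairing ma mb iD D0 abD N rv in h.
have bu2 N := let: And3 _ h _ := osum_pairing mb ma' iD D0 density_rot N ru in h.
have bv2 N := let: And3 _ h _ := osum_pairing mb ma' iD D0 density_rot N rv in h.
have Er x : c * (u x * F1 x + -1 * (v x * F2 x)) =
    complex.Re (((c * F1 x) +i* (c * F2 x)) * phi x).
  by rewrite /u /v; case: (phi x) => r s /=; ring.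
have Ei x : c * (v x * F1 x + 1 * (u x * F2 x)) =
    complex.Im (((c * F1 x) +i* (c * F2 x)) * phi x).
  by rewrite /u /v; case: (phi x) => r s /=; ring.
have jr := intD uF1 (intZ (-1) vF2); have ji := intD vF1 (intZ 1 uF2).
split; first by split; [exact: eq_int Er (intZ c jr)|exact: eq_int Ei (intZ c ji)].
rewrite /cintegral -(eq_Rint Er) -(eq_Rint Ei) (RintZ _ jr) (RintZ _ ji).
rewrite (RintD uF1 (intZ _ vF2)) (RintD vF1 (intZ _ uF2)) (RintZ _ vF2) (RintZ _ uF2).
have Gr xi : complex.Re (fhat f xi * ((c * (trig cos u xi - trig sin v xi)) +i*
     (c * (trig sin u xi + trig cos v xi)))) =
   c * ((a xi * trig cos u xi - b xi * trig sin u xi) +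
    -1 * (b xi * trig cos v xi - a' xi * trig sin v xi)).
  by rewrite /a' /a /b; case: (fhat f xi) => r s /=; ring.
have Gi xi : complex.Im (fhat f xi * ((c * (trig cos u xi - trig sin v xi)) +i*
     (c * (trig sin u xi + trig cos v xi)))) =
   c * ((a xi * trig cos v xi - b xi * trig sin v xi) +
    1 * (b xi * trig cos u xi - a' xi * trig sin u xi)).
  by rewrite /a' /a /b; case: (fhat f xi) => r s /=; ring.
rewrite (eq_Rint Gr) (eq_Rint Gi).
rewrite (pairing_combine bu1 bv2 (eq_int Gr j1) cu1 cv2).
by rewrite (pairing_combine bv1 bu2 (eq_int Gi j2) cv1 cu2).
Qed.

End Distribution.
End Main.

Theorem theorem1p1 (R : realType) (p : R) (f : (R -> R[i]) -> R[i])
    (hp : 4 <= p) (hf : fourier_lebesgue p^-1 (p / 2)%:E f) :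
  exists F : R -> R[i], is_function f F /\
    {ae @lebesgue_measure R, forall x : R,
      (\forall t \near (0 : R)^', schrodinger_defined f t x) /\
      schrodinger f t x @[t --> (0 : R)^'] --> (F x : R[i]^o)}.
Proof.
have [D [iD D0 abD]] := fourier_lebesgue_density hp hf.
have [_ ff _] := hf; have [[ma mb] _] := ff.
have ma' : measurable_fun [set: R] (fun xi => - complex.Re (fhat f xi)).
  by apply: measurableT_comp => //; exact: ma.
have abD' := density_rot abD.
have [F1 [mF1 ae1 iF1 F1c]] := L1_limit ma mb iD D0 abD.
have [F2 [mF2 ae2 iF2 F2c]] := L1_limit mb ma' iD D0 abD'.
(* The same function, the limit of the truncated integrals at time 0, represents [f] and is the
   limit as [t] tends to 0. *)
eexists; split; first exact: (distribution_is_limit iD D0 abD ff mF1 mF2 iF1 iF2 F1c F2c).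
have ffae := ae_filter_ringOfSetsType (@lebesgue_measure R).
apply: (@filterS2 _ _ ffae _ _ _ _ ae1 ae2) => x [l1 [E1 h1 k1]] [l2 [E2 h2 k2]].
have [d s] := schrodinger_cvg h1 h2 k1 k2.
split; first by apply: nearW => t; exact: d.
by rewrite -E1 -E2; exact: s.
Qed.
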